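(* Let $G$ be the Green function of the simple random walk on the oriented lattice $\mathbb{H}$. Let $z=(z_1,0)\in\mathbb{Z}\times\{0\}$ and $y=(y_1,y_2)\in\mathbb{Z}^2$, and suppose that, as $|y|\to\infty$, $y_1y_2^{-2}$ converges to $\lambda\in\mathbb{R}\cup\{\pm\infty\}$. Then for every $\lambda$ there exists a constant $s(\lambda)>0$ such that 1. $G(z,y)\sim s(\pm\infty)\,|y_1-z_1|^{-1/2}$ when $y_1y_2^{-2}$ tends to $\pm\infty$; 2. $G(z,y)\sim s(\lambda)\,|y_2|^{-1}$ when $y_1y_2^{-2}$ converges to $\lambda\in\mathbb{R}$.
   Context: The oriented lattice $\mathbb{H}$ has vertex set $\mathbb{Z}^2$. Put $\epsilon_0=0$, $\epsilon_y=1$ for $y>0$, $\epsilon_y=-1$ for $y<0$. A pair $(u,v)$ is an oriented edge if and only if either $v_1=u_1$ and $v_2=u_2\pm1$, or $\epsilon_{u_2}\neq0$, $v_2=u_2$ and $v_1=u_1+\epsilon_{u_2}$. The simple random walk $(M_n)_{n\ge0}$ jumps from $u$ to each terminal point of an edge with source $u$ with equal probability ($1/3$ if $u_2\neq0$, $1/2$ if $u_2=0$). Its Green function is $G(x,y)=\sum_{n\ge0}\mathbf{P}^x(M_n=y)$ for $x,y\in\mathbb{Z}^2$, where $\mathbf{P}^x$ is the law of the walk started from $x$. The notation $a\sim b$ means that the ratio $a/b$ tends to $1$.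
   Formalization: In item 2 the constant is s(sgn(y_2)λ) instead of s(λ), as the literal claim fails for y_2<0 (s is not even); y_2≠0 is assumed so that y_1 y_2^{-2} is defined; s(±∞) is read as s(+∞), s(−∞) respectively. *)

(* Defs.v *)
From HB Require Import structures.
From mathcomp Require Import all_boot all_order all_algebra.
From mathcomp Require Import all_classical all_reals all_analysis.

Set Implicit Arguments.
Unset Strict Implicit.
Unset Printing Implicit Defensive.

Import Order.TTheory GRing.Theory Num.Theory.
Import numFieldNormedType.Exports.

Local Open Scope classical_set_scope.
Local Open Scope ring_scope.

(* Vertices of the oriented lattice are pairs (u.1, u.2) of integers; [sgz u.2]
   is the orientation of the horizontal line through u. The lattice is invariant
   under x |-> (-x.1, -x.2) but not under x |-> (x.1, -x.2): this is why, when
   y.1 / y.2 ^+ 2 tends to a real l, the Green function at y behaves like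
   s (Num.sg y.2 * l) / `|y.2|, i.e. s l above the axis and s (- l) below. *)
Definition edge (u v : int * int) : bool :=
  ((v.1 == u.1) && ((v.2 == u.2 + 1) || (v.2 == u.2 - 1)))
  || [&& sgz u.2 != 0, v.2 == u.2 & v.1 == u.1 + sgz u.2].

Definition step_prob (R : realType) (u v : int * int) : R :=
  if edge u v then (if u.2 == 0 then 2^-1 else 3^-1) else 0.

(* P^x (M_1 = v_1, ..., M_n = v_n) for t = [:: v_1; ...; v_n]. *)
Fixpoint traj_prob (R : realType) (x : int * int) (t : seq (int * int)) : R :=
  if t is v :: t' then step_prob R x v * traj_prob R v t' else 1.

(* P^x (M_n = y): sum over all trajectories (x, v_1, ..., v_n) with last
   vertex y. *)
Definition walk_prob (R : realType) (n : nat) (x y : int * int) : \bar R :=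
  \esum_(t in [set t : n.-tuple (int * int) | last x t = y])
     (traj_prob R x t)%:E.

Definition green (R : realType) (x y : int * int) : \bar R :=
  (\sum_(0 <= n <oo) walk_prob R n x y)%E.

Definition lattice_norm (R : realType) (y : int * int) : R :=
  Num.sqrt (y.1%:~R ^+ 2 + y.2%:~R ^+ 2).

(* a ~ b: the ratio a / b tends to 1. The limit is taken in \bar R, so that it
   forces a to be finite eventually. *)
Definition asymp_equiv (R : realType) (a : nat -> \bar R) (b : nat -> R) : Prop :=
  (a n * ((b n)^-1)%:E)%E @[n --> \oo] --> 1%:E.

(* Main.v *)
Require Import Defs.
From HB Require Import structures.
From mathcomp Require Import all_boot all_order all_algebra.
From mathcomp Require Import all_classical all_reals all_analysis.
From mathcomp Require Import ring lra zify.
From mathcomp Require Import complex.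

(** Why the statement holds.

Divided by the out-degree of its endpoint, the Green function of a source on
the axis is a function U on the lattice equal, at each vertex, to the average
of U over the in-neighbours, plus a point mass at the source.  A Fourier
series in the horizontal coordinate turns this equation into a second order
recurrence in the height, whose characteristic equation is
r + 1/r = 3 - e^(i theta).  Keeping its root of modulus at most 1 ([croot])
and solving on the axis leads to the formula: at height n > 0 and horizontal
offset m, G = (3/2) [gker] m n with
  [gker] m n = (1/pi) int_0^pi Re (e^(-i m theta) r^n) / (1 - Re r) d theta.
The variable x with theta = 2 x^2 is used throughout, because 1 - r behaves
like (1 - i) x near 0, so that the integrand is a bounded function of x.

The formula is justified without inverting a Fourier transform.  [gker]
satisfies the averaging equation ([gker_rec], [gker_axis]) and tends to 0 at
infinity ([gker_vanishing]).  By the minimum principle a function that tends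
to 0 and dominates its averages is nonnegative ([superharmonic_ge0]).  So the
candidate is nonnegative, hence dominates the partial sums of the Green
series, hence their limit; the difference is equal to its own averages and
tends to 0, so it vanishes ([green_potential]).

The two regimes are two rescalings of one integral.
- If m / n^2 tends to l, put x = v / n: r^n tends to e^(-(1 - i) v) and
  n [gker] m n tends to (4/pi) int_0^oo e^(-v) cos (v - 2 l v^2) dv
  ([gker_near]).
- If n^2 / |m| tends to 0, put x = v / sqrt |m|: r^n tends to 1 and
  sqrt |m| [gker] m n tends to (4/pi) int_0^oo cos (2 v^2) dv ([gker_far]).
  This integral converges only conditionally.  Its tail is controlled,
  uniformly in n, by translating theta by pi / |m|: this changes the sign of
  e^(-i m theta) and moves the other factors very little
  ([integrand_tail_shift]).

The limits must be positive.  For the Fresnel integral two integrations by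
parts exhibit a nonnegative integrand ([fresnel_increment]).  For the other
one the integrand oscillates, and positivity comes from the walk: [gker] m 0
is at least c (1 + |m|)^(-1/2), and above the axis the abscissa only
increases, so the minimum principle on a quadrant compares [gker] with an
explicit exponential solution and gives n [gker] m n >= c' when |m| / n^2 is
bounded ([gker_lower_bound]).

Vertices below the axis reduce to vertices above it by the central symmetry
of the lattice, which changes the sign of m; hence the sign in front of the
limit slope l.
*)

Set Implicit Arguments.
Unset Strict Implicit.
Unset Printing Implicit Defensive.

Import Order.TTheory GRing.Theory Num.Theory.
Import numFieldNormedType.Exports.
Import Normc.

Local Open Scope classical_set_scope.
Local Open Scope ring_scope.

Local Notation Re := complex.Re.
Local Notation Im := complex.Im.

(** * Complex moduli and the unit circle *)

Section Complex.
Variable R : realType.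
Implicit Types (t x y : R) (z w : R[i]).

Lemma ReD z w : Re (z + w) = Re z + Re w.
Proof. by case: z w => [a b] [c d]. Qed.

Lemma ReN z : Re (- z) = - Re z.
Proof. by case: z. Qed.

Lemma ReM z w : Re (z * w) = Re z * Re w - Im z * Im w.
Proof. by case: z w => [a b] [c d]. Qed.

Lemma normc_ge0 z : 0 <= normc z.
Proof. by case: z => a b /=; rewrite sqrtr_ge0. Qed.

Lemma normcX z n : normc (z ^+ n) = normc z ^+ n.
Proof.
elim: n => [|n IH]; first by rewrite !expr0 normc1.
by rewrite !exprS normcM IH.
Qed.

Lemma normc_sqr z : normc z ^+ 2 = Re z ^+ 2 + Im z ^+ 2.
Proof. by case: z => a b /=; rewrite sqr_sqrtr// addr_ge0 ?sqr_ge0. Qed.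

Lemma normcD z w : normc (z + w) <= normc z + normc w.
Proof. exact: le_normcD. Qed.

Lemma normcB z w : normc (z - w) <= normc z + normc w.
Proof. by rewrite (le_trans (normcD _ _))// normcN. Qed.

Lemma distcC z w : normc (z - w) = normc (w - z).
Proof. by rewrite -normcN opprB. Qed.

Lemma Re_le_normc z : `|Re z| <= normc z.
Proof.
rewrite -(@ler_pXn2r _ 2%N) ?nnegrE ?normc_ge0// normc_sqr real_normK ?num_real//.
by rewrite lerDl sqr_ge0.
Qed.

Lemma Im_le_normc z : `|Im z| <= normc z.
Proof.
rewrite -(@ler_pXn2r _ 2%N) ?nnegrE ?normc_ge0// normc_sqr real_normK ?num_real//.
by rewrite lerDr sqr_ge0.
Qed.

Lemma normc_leD z : normc z <= `|Re z| + `|Im z|.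
Proof.
rewrite -(@ler_pXn2r _ 2%N) ?nnegrE ?normc_ge0 ?addr_ge0// normc_sqr.
rewrite -(real_normK (num_real (Re z))) -(real_normK (num_real (Im z))).
by have := normr_ge0 (Re z); have := normr_ge0 (Im z); nra.
Qed.

(** Telescoping z^n - w^n; the power M^(n-1) is what makes the bound
summable against the decay of the root. *)
Lemma normcBX z w M n : normc z <= M -> normc w <= M ->
  normc (z ^+ n - w ^+ n) <= n%:R * M ^+ n.-1 * normc (z - w).
Proof.
move=> zM wM; have M0 : 0 <= M by apply: le_trans zM; exact: normc_ge0.
case: n => [|n]; first by rewrite !expr0 subrr normc0 !mul0r.
rewrite /=; elim: n => [|n IH]; first by rewrite !expr1 expr0 !mul1r.
rewrite exprS (exprS w).
have -> : z * z ^+ n.+1 - w * w ^+ n.+1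
        = z ^+ n.+1 * (z - w) + w * (z ^+ n.+1 - w ^+ n.+1) by ring.
apply: le_trans (normcD _ _) _; rewrite !normcM normcX.
have -> : n.+2%:R * M ^+ n.+1 * normc (z - w)
   = M ^+ n.+1 * normc (z - w) + M * (n.+1%:R * M ^+ n * normc (z - w)).
  by rewrite -[n.+2%:R]natr1 (exprS M n); ring.
apply: lerD; first by rewrite ler_wpM2r ?normc_ge0// lerXn2r ?nnegrE ?normc_ge0.
by apply: ler_pM => //; exact: normc_ge0.
Qed.

Definition cis t : R[i] := (cos t +i* sin t)%C.

Lemma normc_cis t : normc (cis t) = 1.
Proof. by rewrite /= cos2Dsin2 sqrtr1. Qed.

Lemma cisD t x : cis (t + x) = cis t * cis x.
Proof.
rewrite /cis cosD sinD -[RHS]/((_ +i* _)%C); congr (_ +i* _)%C.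
by rewrite addrC mulrC.
Qed.

Lemma cis0 : cis 0 = 1.
Proof. by rewrite /cis cos0 sin0. Qed.

Lemma cispi t : cis (t + pi) = - cis t.
Proof. by rewrite /cis cosDpi sinDpi. Qed.

Lemma cisMn t n : cis (t *+ n) = cis t ^+ n.
Proof.
elim: n => [|n IH]; first by rewrite mulr0n cis0 expr0.
by rewrite mulrS cisD IH exprS.
Qed.

Lemma sin_le t : 0 <= t -> sin t <= t.
Proof.
move=> t0; rewrite -subr_ge0.
have := @ger0_derive1_ndecry R (fun x => x - sin x) 0 _ _ _ 0 t (lexx _) t0.
rewrite sin0 subr0; apply.
- by move=> x _; apply: derivableB => //.
- move=> x _; rewrite derive1E derive_val /GRing.scale/=.
  by rewrite subr_ge0 ?mulr1 cos_le1.
- apply: continuous_subspaceT => x.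
  by apply: continuousB => //; exact: continuous_sin.
Qed.

Lemma norm_sin_le t : `|sin t| <= `|t|.
Proof.
wlog t0 : t / 0 <= t => [H|].
  have [/H//|/ltW t0] := leP 0 t.
  by have := H (- t); rewrite oppr_ge0 sinN !normrN; apply.
rewrite (ger0_norm t0) ler_norml sin_le// andbT.
have [t1|t1] := leP t 1; last first.
  by rewrite (le_trans _ (sin_geN1 t))// lerN2 ltW.
rewrite (le_trans (y := 0)) ?oppr_le0//; apply: sin_ge0_pi.
by rewrite t0/= (le_trans t1)// (le_trans _ (pi_ge2 _))// ler1n.
Qed.

Lemma cos_half t : 1 - cos t = 2 * sin (t / 2) ^+ 2.
Proof.
have -> : cos t = cos ((t / 2) *+ 2) by congr cos; rewrite -mulr_natr; field.
by rewrite cos_mulr2n sin2cos2; ring.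
Qed.

Lemma cos_ge t : 1 - cos t <= t ^+ 2 / 2.
Proof.
rewrite cos_half.
have := norm_sin_le (t / 2).
rewrite -(@ler_pXn2r _ 2%N) ?nnegrE// !real_normK ?num_real// expr_div_n; lra.
Qed.

(** The derivative of the difference is bounded below by [cos_ge]. *)
Lemma sin_ge t : 0 <= t -> t - t ^+ 3 / 6 <= sin t.
Proof.
move=> t0; rewrite -subr_ge0.
have := @ger0_derive1_ndecry R (fun x => sin x - (x - x ^+ 3 / 6)) 0 _ _ _ 0 t
  (lexx _) t0.
rewrite sin0 expr0n/= mul0r !subr0; apply.
- by move=> x _.
- move=> x _; rewrite derive1E derive_val /GRing.scale/=.
  by have := cos_ge x; rewrite ?mulr1; lra.
- apply: continuous_subspaceT => x.
  apply: differentiable_continuous; apply/derivable1_diffP; by [].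
Qed.

Lemma normc_cisB1 t : normc (cis t - 1) <= `|t|.
Proof.
rewrite -(@ler_pXn2r _ 2%N) ?nnegrE ?normc_ge0// normc_sqr real_normK ?num_real//=.
rewrite subr0.
have := cos_ge t; have := cos2Dsin2 t; nra.
Qed.

Lemma normc_cisB t x : normc (cis t - cis x) <= `|t - x|.
Proof.
have -> : cis t - cis x = cis x * (cis (t - x) - 1).
  by rewrite mulrBr mulr1 -cisD [x + _]addrC subrK.
by rewrite normcM normc_cis mul1r normc_cisB1.
Qed.

Lemma normc_cis_lin t : 0 <= t <= 4 -> normc (cis t - 1 - (0 +i* t)%C) <= 2 * t ^+ 2.
Proof.
move=> /andP[t0 t4].
have -> : cis t - 1 - (0 +i* t)%C = ((cos t - 1) +i* (sin t - t))%C.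
  by rewrite -[LHS]/((cos t - 1 - 0) +i* (sin t - 0 - t))%C !subr0.
apply: le_trans (normc_leD _) _ => /=.
rewrite ler0_norm ?subr_le0 ?cos_le1// ler0_norm ?subr_le0 ?sin_le//.
have := cos_ge t; have := sin_ge t0; nra.
Qed.

End Complex.

(** * The decaying root of r + 1/r = 3 - e^(i theta) *)

Section Root.
Variable R : realType.
Implicit Types (t x y : R) (z w r : R[i]).

(** The two roots have product 1, so one of them has modulus at most 1. *)
Lemma small_root_exists z : exists r, r ^+ 2 - z * r + 1 = 0 /\ normc r <= 1.
Proof.
pose d := sqrtc (z ^+ 2 - 4).
have dE : d ^+ 2 = z ^+ 2 - 4 by rewrite sqr_sqrtc.
have h2 : (2 : R[i]) != 0 by rewrite pnatr_eq0.
have prod1 : ((z - d) / 2) * ((z + d) / 2) = 1.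
  have -> : ((z - d) / 2) * ((z + d) / 2) = (z ^+ 2 - d ^+ 2) / 4 by field.
  by rewrite dE; field.
have root1 : ((z - d) / 2) ^+ 2 - z * ((z - d) / 2) + 1 = 0.
  by rewrite -[X in _ + X]prod1; field.
have root2 : ((z + d) / 2) ^+ 2 - z * ((z + d) / 2) + 1 = 0.
  by rewrite -[X in _ + X]prod1; field.
have [le1|gt1] := leP (normc ((z - d) / 2)) 1; first by exists ((z - d) / 2).
exists ((z + d) / 2); split => //.
have : normc ((z - d) / 2) * normc ((z + d) / 2) = 1 by rewrite -normcM prod1 normc1.
have := normc_ge0 ((z + d) / 2); nra.
Qed.

(** The value e^(i theta) at theta = 2 x^2. *)
Definition phase x : R[i] := cis (2 * x ^+ 2).

Definition croot x : R[i] :=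
  xget 0 [set r | r ^+ 2 - (3 - phase x) * r + 1 = 0 /\ normc r <= 1].

Lemma crootP x : croot x ^+ 2 - (3 - phase x) * croot x + 1 = 0 /\ normc (croot x) <= 1.
Proof.
have [r rP] := small_root_exists (3 - phase x).
exact: (@xgetPex _ 0 [set r | r ^+ 2 - (3 - phase x) * r + 1 = 0 /\ normc r <= 1]
  (ex_intro _ r rP)).
Qed.

Lemma crootE x : croot x ^+ 2 - (3 - phase x) * croot x + 1 = 0.
Proof. by case: (crootP x). Qed.

Lemma croot_le1 x : normc (croot x) <= 1.
Proof. by case: (crootP x). Qed.

Lemma normc_nat n : normc (n%:R : R[i]) = n%:R.
Proof. by rewrite -[n%:R]/(1 *+ n) normcMn normc1. Qed.

Lemma croot_ge x : 5^-1 <= normc (croot x).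
Proof.
have : croot x * (3 - phase x - croot x) = 1 
  by rewrite -[RHS]subr0 -(crootE x); ring.
move=> /(congr1 (@normc R)); rewrite normcM normc1.
have : normc (3 - phase x - croot x) <= 5.
  apply: le_trans (normcB _ _) _.
  have := croot_le1 x; have := normcB 3 (phase x).
  by rewrite normc_nat normc_cis; lra.
have := normc_ge0 (3 - phase x - croot x); have := normc_ge0 (croot x).
by nra.
Qed.

Lemma sin_ge_third t : 0 <= t <= 2 -> t / 3 <= sin t.
Proof.
move=> /andP[t0 t2]; apply: le_trans (sin_ge t0); nra.
Qed.

(** The spectral gap of the root.  Let s = |r|^2, A = (1 - s)^2 and
c = 1 - cos theta.  The real and imaginary parts of conj(r) times the
characteristic equation eliminate r and leave
A^2 = 6 c s A + 4 s^2 c (2 - c); since moreover A >= 4 c s, this gives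
A^2 >= 8 c s^2, so 1 - s is at least of order theta^(1/2). *)
Lemma one_sub_croot_ge x : 0 <= x -> x ^+ 2 <= 2 -> x / 10 <= 1 - normc (croot x).
Proof.
move=> x0 x2.
have := crootE x; have := croot_ge x; have := croot_le1 x; have := normc_sqr (croot x).
set C := cos (2 * x ^+ 2); set S := sin (2 * x ^+ 2).
have CS : C ^+ 2 + S ^+ 2 = 1 by exact: cos2Dsin2.
have Cle1 : C <= 1 by exact: cos_le1.
have CgeN1 : -1 <= C by exact: cos_geN1.
have cx : x ^+ 4 * (2 / 9) <= 1 - C.
  rewrite /C cos_half (_ : 2 * x ^+ 2 / 2 = x ^+ 2); last by field.
  have /sin_ge_third : 0 <= x ^+ 2 <= 2 by rewrite sqr_ge0.
  have := sqr_ge0 x; set y := x ^+ 2 => y0.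
  have -> : x ^+ 4 = y ^+ 2 by rewrite /y -exprM.
  by nra.
rewrite /phase /cis -/C -/S; move: (normc (croot x)) => a.
case: (croot x) => p q /= sE ale1 age /eqP.
have three : (3 : R[i]) = (3 +i* 0)%C.
  by rewrite (_ : 3 = (3 : R)%:C%C)// rmorph_nat.
rewrite expr2 three.
rewrite -[_ + 1]/(((p * p - q * q) - ((3 - C) * p - (0 - S) * q) + 1) +i*
   ((p * q + q * p) - ((3 - C) * q + (0 - S) * p) + 0))%C.
rewrite eq_complex /= => /andP[/eqP eR /eqP eI].
set s := a ^+ 2 in sE *.
have s1 : s <= 1 by rewrite /s; nra.
have s0 : 1 / 25 <= s by rewrite /s; nra.
have e1 : p * (1 + s) = (3 - C) * s.
  apply/eqP; rewrite -subr_eq0; apply/eqP.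
  transitivity (p * (p * p - q * q - (3 - C) * p - S * q + 1)
              + q * (2 * p * q - (3 - C) * q + S * p)); first by rewrite sE; ring.
  transitivity (p * 0 + q * 0 : R); last by ring.
  by congr (_ * _ + _ * _); [rewrite -[RHS]eR|rewrite -[RHS]eI]; ring.
have e2 : q * (1 - s) = S * s.
  apply/eqP; rewrite -subr_eq0; apply/eqP.
  transitivity (q * (p * p - q * q - (3 - C) * p - S * q + 1)
              - p * (2 * p * q - (3 - C) * q + S * p)); first by rewrite sE; ring.
  transitivity (q * 0 - p * 0 : R); last by ring.
  by congr (_ * _ - _ * _); [rewrite -[RHS]eR|rewrite -[RHS]eI]; ring.
clear eR eI.
set c := 1 - C in cx *.
have c0 : 0 <= c by rewrite /c; lra.
have c2 : c <= 2 by rewrite /c; lra.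
have e1' : p * (1 + s) = (2 + c) * s by rewrite e1 /c; ring.
have S2 : S ^+ 2 = c * (2 - c) by rewrite /c; nra.
set A := (1 - s) ^+ 2.
have Ale : (4 * c + c ^+ 2) * s <= A.
  have : (p * (1 + s)) ^+ 2 <= s * (1 + s) ^+ 2.
    by rewrite exprMn ler_wpM2r ?sqr_ge0// sE lerDl sqr_ge0.
  rewrite e1' => H.
  have : s * ((2 + c) ^+ 2 * s) <= s * (1 + s) ^+ 2 by apply: le_trans H; rewrite exprMn; lra.
  rewrite ler_pM2l; last by lra.
  rewrite /A; lra.
have AE : A ^+ 2 = 6 * c * s * A + 4 * s ^+ 2 * c * (2 - c).
  have : s * (1 + s) ^+ 2 * (1 - s) ^+ 2 =
      s * (s * ((2 + c) ^+ 2 * (1 - s) ^+ 2 + c * (2 - c) * (1 + s) ^+ 2)).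
    transitivity ((p * (1 + s)) ^+ 2 * (1 - s) ^+ 2 + (q * (1 - s)) ^+ 2 * (1 + s) ^+ 2).
      rewrite {1}sE; ring.
    rewrite e1' e2 [X in _ + X * _]exprMn S2; ring.
  rewrite -mulrA; move/mulfI => /(_ ltac:(by apply: lt0r_neq0; lra)).
  by rewrite /A; lra.
have A2 : 8 * c * s ^+ 2 <= A ^+ 2.
  rewrite AE -subr_ge0.
  have -> : 6 * c * s * A + 4 * s ^+ 2 * c * (2 - c) - 8 * c * s ^+ 2 = c * s * (6 * A - 4 * c * s) by ring.
  apply: mulr_ge0; first by apply: mulr_ge0 => //; lra.
  have : 0 <= c ^+ 2 * s by apply: mulr_ge0; [exact: sqr_ge0|lra].
  have : 0 <= c * s by apply: mulr_ge0; lra.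
  by lra.
have A3 : (4 / 3 * x ^+ 2 * s) ^+ 2 <= A ^+ 2.
  apply: le_trans A2.
  have -> : (4 / 3 * x ^+ 2 * s) ^+ 2 = 8 * (x ^+ 4 * (2 / 9)) * s ^+ 2 by field.
  by rewrite ler_wpM2r ?sqr_ge0// ler_wpM2l.
have A4 : 4 / 3 * x ^+ 2 * s <= A.
  rewrite -(@ler_pXn2r _ 2%N) ?nnegrE//; last exact: sqr_ge0.
  by apply: mulr_ge0; [apply: mulr_ge0; [lra|exact: sqr_ge0]|lra].
have A5 : (x / 5) ^+ 2 <= (1 - s) ^+ 2.
  apply: le_trans A4; have := sqr_ge0 x; nra.
have : x / 5 <= 1 - s.
  by rewrite -(@ler_pXn2r _ 2%N) ?nnegrE//; lra.
by rewrite /s; nra.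
Qed.

End Root.

(** * Behaviour of the root near theta = 0 *)

Section RootEstimates.
Variable R : realType.
Implicit Types (t x y : R) (z w r : R[i]).

Lemma Re_croot_le x : Re (croot x) <= normc (croot x).
Proof. exact: le_trans (ler_norm _) (Re_le_normc _). Qed.

Lemma one_sub_Re_croot_ge x : 0 <= x -> x ^+ 2 <= 2 -> x / 10 <= 1 - Re (croot x).
Proof.
move=> x0 x2; apply: le_trans (one_sub_croot_ge x0 x2) _.
by rewrite lerD2l lerN2 Re_croot_le.
Qed.

Lemma one_sub_croot_sqr x : (1 - croot x) ^+ 2 = croot x * (1 - phase x).
Proof.
apply/eqP; rewrite -subr_eq0; apply/eqP; rewrite -[RHS](crootE x); ring.
Qed.

Lemma one_sub_croot_le x : 0 <= x -> normc (1 - croot x) <= 2 * x.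
Proof.
move=> x0; rewrite -(@ler_pXn2r _ 2%N) ?nnegrE ?normc_ge0 ?mulr_ge0//.
rewrite -normcX one_sub_croot_sqr normcM distcC.
have := normc_cisB1 (2 * x ^+ 2); have := croot_le1 x; have := normc_ge0 (croot x).
rewrite /phase (ger0_norm (_ : 0 <= 2 * x ^+ 2)); last by rewrite mulr_ge0 ?sqr_ge0.
have := normc_ge0 (cis (2 * x ^+ 2) - 1).
by have := sqr_ge0 x; nra.
Qed.

Lemma normc_real x : normc (x%:C)%C = `|x|.
Proof. by rewrite /= expr0n addr0 sqrtr_sqr. Qed.

(** The number (1 - i) x. *)
Definition oneBi x : R[i] := (x -i* x)%C.

(** Both (1 - r)^2 = r (1 - e^(i theta)) and ((1 - i) x)^2 = - 2 i x^2
have the same leading term; the difference of squares factors, and the factor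
1 - r + (1 - i) x has real part at least x, so the other one is O(x^2).  This
selects the correct square root without any branch choice. *)
Lemma croot_lin x : 0 <= x -> x ^+ 2 <= 2 ->
  normc (croot x - (1 - oneBi x)) <= 16 * x ^+ 2.
Proof.
move=> x0 x2; have [->|xn0] := eqVneq x 0.
  have := one_sub_croot_le (lexx 0); rewrite mulr0 distcC.
  by rewrite (_ : oneBi 0 = 0) ?subr0 ?expr0n ?mulr0// /oneBi oppr0.
have {xn0} x0' : 0 < x by rewrite lt_def xn0.
pose P := 1 - croot x - oneBi x; pose Q := 1 - croot x + oneBi x.
have -> : croot x - (1 - oneBi x) = - P by rewrite /P; ring.
rewrite normcN.
have d2 : oneBi x ^+ 2 = - (0 +i* (2 * x ^+ 2))%C.
  rewrite expr2 -[LHS]/((x * x - (- x) * (- x)) +i* (x * (- x) + (- x) * x))%C.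
  rewrite -[RHS]/((- 0) +i* (- (2 * x ^+ 2)))%C.
  by congr (_ +i* _)%C; ring.
have PQ : P * Q = croot x * (1 - phase x) + (0 +i* (2 * x ^+ 2))%C.
  by rewrite -one_sub_croot_sqr -[X in _ + X]opprK -d2 /P /Q; ring.
have nPQ : normc P * normc Q <= 16 * x ^+ 3.
  rewrite -normcM PQ.
  have -> : croot x * (1 - phase x) + (0 +i* (2 * x ^+ 2))%C =
    (1 - croot x) * (0 +i* (2 * x ^+ 2))%C - croot x * (phase x - 1 - (0 +i* (2 * x ^+ 2))%C) by ring.
  apply: le_trans (normcB _ _) _; rewrite !normcM.
  have -> : normc (0 +i* (2 * x ^+ 2))%C = 2 * x ^+ 2.
    by rewrite /= expr0n add0r sqrtr_sqr ger0_norm// mulr_ge0 ?sqr_ge0.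
  have := @normc_cis_lin _ (2 * x ^+ 2); rewrite -/(phase x)
    => /(_ ltac:(by rewrite mulr_ge0 ?sqr_ge0//=; lra)) H.
  have K1 : normc (croot x) * normc (phase x - 1 - (0 +i* (2 * x ^+ 2))%C) <= 2 * (2 * x ^+ 2) ^+ 2.
    apply: le_trans H; rewrite ler_piMl ?normc_ge0// croot_le1//.
  have K2 : normc (1 - croot x) * (2 * x ^+ 2) <= 2 * x * (2 * x ^+ 2).
    by rewrite ler_wpM2r ?one_sub_croot_le// mulr_ge0 ?sqr_ge0.
  apply: le_trans (lerD K2 K1) _.
  have x32 : x <= 3 / 2 by nra.
  rewrite -subr_ge0 (_ : _ - _ = x ^+ 3 * (12 - 8 * x)); last by ring.
  by rewrite mulr_ge0 ?exprn_ge0//; lra.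
have Qx : x <= normc Q.
  apply: le_trans (Re_le_normc _); apply: le_trans (ler_norm _).
  rewrite /Q !ReD ReN /=; have := Re_croot_le x; have := croot_le1 x; lra.
have : normc P * x <= 16 * x ^+ 2 * x.
  apply: le_trans (_ : 16 * x ^+ 3 <= _); last by rewrite le_eqVlt; apply/orP; left; apply/eqP; ring.
  by apply: le_trans nPQ; rewrite ler_wpM2l ?normc_ge0.
by rewrite ler_pM2r.
Qed.

(** Subtracting the characteristic equations at x and y gives
(r - r')(1 - r r') = (w - w') r r' with w, w' the two phases, so the gap
1 - |r| converts a variation of the phase into a variation of the root. *)
Lemma croot_lip x y : 0 < x -> x ^+ 2 <= 2 ->
  normc (croot x - croot y) <= 20 * `|x ^+ 2 - y ^+ 2| / x.
Proof.
move=> x0 x2; rewrite ler_pdivlMr//.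
have e : (croot x - croot y) * (1 - croot x * croot y) = (phase x - phase y) * (croot x * croot y).
  apply/eqP; rewrite -subr_eq0; apply/eqP.
  transitivity (croot x * (croot y ^+ 2 - (3 - phase y) * croot y + 1)
     - croot y * (croot x ^+ 2 - (3 - phase x) * croot x + 1)); first by ring.
  by rewrite !crootE; ring.
have n1 : x / 10 <= normc (1 - croot x * croot y).
  have : 1 <= normc (1 - croot x * croot y) + normc (croot x * croot y).
    by rewrite -[leLHS](normc1 R) -{1}(subrK (croot x * croot y) 1) normcD.
  rewrite normcM.
  have := one_sub_croot_ge (ltW x0) x2; have := croot_le1 y; have := normc_ge0 (croot x); nra.
have n2 : normc (phase x - phase y) <= 2 * `|x ^+ 2 - y ^+ 2|.
  apply: le_trans (normc_cisB _ _) _.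
  by rewrite -mulrBr normrM ger0_norm.
have : normc (croot x - croot y) * (x / 10) <= 2 * `|x ^+ 2 - y ^+ 2|.
  apply: le_trans (_ : normc (croot x - croot y) * normc (1 - croot x * croot y) <= _).
    by rewrite ler_wpM2l ?normc_ge0.
  rewrite -normcM e normcM; apply: le_trans n2.
  rewrite ler_piMr ?normc_ge0// normcM mulr_ile1 ?normc_ge0 ?croot_le1//.
by lra.
Qed.

Lemma croot_lipschitz x y : 0 <= x -> x ^+ 2 <= 2 -> 0 <= y -> y ^+ 2 <= 2 ->
  normc (croot x - croot y) <= 40 * `|x - y|.
Proof.
wlog xy : x y / y <= x => [H|].
  have [/H//|/ltW yx] := leP y x => x0 x2 y0 y2.
  by rewrite distcC distrC; exact: H.
move=> x0 x2 y0 y2; have [x00|xn0] := eqVneq x 0.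
  have -> : y = x by lra.
  by rewrite !subrr normc0 normr0 mulr0.
have {}x0 : 0 < x by rewrite lt_def xn0.
apply: le_trans (croot_lip y x0 x2) _.
rewrite ler_pdivrMr// subr_sqr normrM (ger0_norm (_ : 0 <= x + y)); last lra.
by have := normr_ge0 (x - y); nra.
Qed.

(** The number e^(-(1 - i) x). *)
Definition cexp x : R[i] := (expR (- x))%:C%C * cis x.

Lemma normc_cexp x : normc (cexp x) = expR (- x).
Proof. by rewrite normcM normc_cis mulr1 normc_real ger0_norm ?expR_ge0. Qed.

Lemma cexpX x n : cexp x ^+ n = cexp (n%:R * x).
Proof.
rewrite /cexp exprMn -cisMn -rmorphXn -expRM_natl -[x *+ n]mulr_natl.
by rewrite mulrN.
Qed.

Lemma cexp_lin x : 0 <= x -> x <= 2 -> normc (cexp x - (1 - oneBi x)) <= 4 * x ^+ 2.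
Proof.
move=> x0 x2; set E := expR (- x).
have E1 : 1 - x <= E by exact: expR_ge1Dx.
have E2 : E * (1 + x) <= 1.
  have : E * expR x = 1 by rewrite mulrC expRxMexpNx_1.
  have := expR_ge1Dx x; have : 0 <= E by exact: expR_ge0.
  by move=> E0 Ex EE; rewrite -[leRHS]EE ler_wpM2l.
have E0 : 0 <= E by exact: expR_ge0.
have -> : cexp x - (1 - oneBi x) = (E%:C)%C * (cis x - 1 - (0 +i* x)%C)
   + (E - 1 + x)%:C%C + (0 +i* x)%C * (E - 1)%:C%C.
  have -> : oneBi x = x%:C%C - (0 +i* x)%C.
    by rewrite -[RHS]/((x - 0) +i* (0 - x))%C subr0 sub0r.
  by rewrite /cexp -/E !rmorphD !rmorphN !rmorph1; ring.
apply: le_trans (normcD _ _) _; rewrite [X in _ + X]normcM !normc_real.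
have nI : normc (0 +i* x)%C = x by rewrite /= expr0n add0r sqrtr_sqr ger0_norm.
rewrite nI -lerBrDr.
apply: le_trans (normcD _ _) _; rewrite !normcM !normc_real.
have := @normc_cis_lin _ x => /(_ ltac:(lra)).
have := normc_ge0 (cis x - 1 - (0 +i* x)%C); move: (normc _) => N N0 NL.
rewrite (ger0_norm E0) (ger0_norm (_ : 0 <= E - 1 + x)); last lra.
rewrite ler0_norm; last by nra.
nra.
Qed.

Lemma croot_cexp x : 0 <= x -> x ^+ 2 <= 2 -> normc (croot x - cexp x) <= 20 * x ^+ 2.
Proof.
move=> x0 x2.
have -> : croot x - cexp x = (croot x - (1 - oneBi x)) - (cexp x - (1 - oneBi x)) by ring.
apply: le_trans (normcB _ _) _.
have := croot_lin x0 x2; have := @cexp_lin x x0 => /(_ ltac:(nra)); lra.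
Qed.

Lemma one_sub_Re_croot_lin x : 0 <= x -> x ^+ 2 <= 2 ->
  `|1 - Re (croot x) - x| <= 16 * x ^+ 2.
Proof.
move=> x0 x2; apply: le_trans (croot_lin x0 x2).
apply: le_trans (Re_le_normc _); rewrite ReD ReN ReD ReN /=.
by rewrite -normrN le_eqVlt; apply/orP; left; apply/eqP; congr `|_|; ring.
Qed.

End RootEstimates.

(** * Integrals of continuous functions over segments *)

Section IntervalIntegral.
Variable R : realType.
Implicit Types (a b c x y : R) (f g : R -> R).

(** Two-sided continuity at every point of the segment, endpoints included: it
is stable under composition and needs no subspace topology. *)
Definition cts a b f := forall x, a <= x <= b -> {for x, continuous f}.

Definition Int a b f : R := (\int[@lebesgue_measure R]_(x in `[a, b]) f x)%R.

Lemma cts_within a b f : cts a b f -> {within `[a, b], continuous f}.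
Proof.
move=> cf; apply: continuous_in_subspaceT => x.
by rewrite inE/= in_itv/= => /cf.
Qed.

Lemma cts_integrable a b f : cts a b f ->
  (@lebesgue_measure R).-integrable `[a, b] (EFin \o f).
Proof.
move=> cf; apply: continuous_compact_integrable; first exact: segment_compact.
exact: cts_within.
Qed.

Lemma cts_sub a b c d f : cts a b f -> a <= c -> d <= b -> cts c d f.
Proof.
move=> cf ac db x /andP[cx xd]; apply: cf.
by rewrite (le_trans ac cx) (le_trans xd db).
Qed.

Lemma ctsD a b f g : cts a b f -> cts a b g -> cts a b (fun x => f x + g x).
Proof. by move=> cf cg x xab; apply: continuousD; [exact: cf|exact: cg]. Qed.

Lemma ctsB a b f g : cts a b f -> cts a b g -> cts a b (fun x => f x - g x).
Proof. by move=> cf cg x xab; apply: continuousB; [exact: cf|exact: cg]. Qed.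

Lemma ctsM a b f g : cts a b f -> cts a b g -> cts a b (fun x => f x * g x).
Proof. by move=> cf cg x xab; apply: continuousM; [exact: cf|exact: cg]. Qed.

Lemma cts_cst a b c : cts a b (fun=> c).
Proof. by move=> x _; exact: cst_continuous. Qed.

Lemma cts_norm a b f : cts a b f -> cts a b (fun x => `|f x|).
Proof. move=> cf x /cf h; apply: (continuous_comp h); exact: norm_continuous. Qed.

Lemma IntD a b f g : cts a b f -> cts a b g ->
  Int a b (fun x => f x + g x) = Int a b f + Int a b g.
Proof. by move=> cf cg; rewrite /Int RintegralD//; exact: cts_integrable. Qed.

Lemma IntB a b f g : cts a b f -> cts a b g ->
  Int a b (fun x => f x - g x) = Int a b f - Int a b g.
Proof. by move=> cf cg; rewrite /Int RintegralB//; exact: cts_integrable. Qed.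

Lemma IntZ a b c f : cts a b f -> Int a b (fun x => c * f x) = c * Int a b f.
Proof. by move=> cf; rewrite /Int RintegralZl//; exact: cts_integrable. Qed.

Lemma eq_Int a b f g : (forall x, a <= x <= b -> f x = g x) -> Int a b f = Int a b g.
Proof.
move=> fg; apply: eq_Rintegral => x; rewrite inE/= in_itv/=; exact: fg.
Qed.

Lemma Int_cst a b c : a <= b -> Int a b (fun=> c) = c * (b - a).
Proof.
move=> ab; transitivity (c * fine (lebesgue_measure (`[a, b]%classic : set R))).
  exact: Rintegral_cst.
rewrite lebesgue_measure_itv/= lte_fin; congr (_ * _).
by case: ltP => [//|ba]; rewrite (_ : b - a = 0)//; apply/eqP; rewrite subr_eq0 eq_le ab ba.
Qed.

Lemma le_Int a b f g : cts a b f -> cts a b g ->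
  (forall x, a <= x <= b -> f x <= g x) -> Int a b f <= Int a b g.
Proof.
move=> cf cg fg; apply: le_Rintegral => //.
- exact: (cts_integrable cf).
- exact: (cts_integrable cg).
Qed.

Lemma norm_Int_le a b f g : cts a b f -> cts a b g ->
  (forall x, a <= x <= b -> `|f x| <= g x) -> `|Int a b f| <= Int a b g.
Proof.
move=> cf cg fg; apply: le_trans (le_Int (cts_norm cf) cg fg).
by apply: le_normr_Rintegral => //; exact: cts_integrable.
Qed.

Lemma Int_split a b c f : a <= c -> c <= b -> cts a b f ->
  Int a b f = Int a c f + Int c b f.
Proof.
move=> ac cb cf.
have H := @Rintegral_itvB R f (BLeft a) (BRight b) c (cts_integrable cf).
have {}H : Int a b f - Int a c f = Int c b f.
  rewrite /Int H ?bnd_simp//; apply: Rintegral_itv_obnd_cbnd.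
  apply: integrableS (cts_integrable cf) => //.
  by apply: subset_itv; rewrite bnd_simp.
by rewrite -H addrC subrK.
Qed.

Lemma Int_FTC a b f (F : R -> R) : a <= b -> cts a b f ->
  (forall x, a <= x <= b -> is_derive x 1 F (f x)) -> Int a b f = F b - F a.
Proof.
rewrite le_eqVlt => /orP[/eqP <- _ _|ab cf dF].
  by rewrite /Int set_itv1 Rintegral_set1 subrr.
rewrite /Int /Rintegral (@continuous_FTC2 _ f F)//.
- exact: cts_within.
- have cF x : a <= x <= b -> {for x, continuous F}.
    move=> /dF dFx; apply: differentiable_continuous; apply/derivable1_diffP.
    exact: ex_derive.
  split.
  + move=> x; rewrite in_itv/= => /andP[ax xb].
    by have := dF x; rewrite !ltW// => /(_ isT) dFx; exact: ex_derive.
  + by apply: cvg_at_right_filter; apply: cF; rewrite lexx ltW.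
  + by apply: cvg_at_left_filter; apply: cF; rewrite lexx ltW.
- move=> x; rewrite in_itv/= => /andP[ax xb].
  have := dF x; rewrite !ltW// => /(_ isT) dFx.
  by rewrite derive1E; exact: derive_val.
Qed.

(** Both the substituting function and its derivative may be given by formulas
valid only on the segment. *)
Lemma Int_subst a b f (F F' : R -> R) : a <= b ->
  (forall x y, a <= x -> x < y -> y <= b -> F x < F y) ->
  (forall x, a <= x <= b -> is_derive x 1 F (F' x)) ->
  cts a b F' -> cts (F a) (F b) f ->
  Int (F a) (F b) f = Int a b (fun x => f (F x) * F' x).
Proof.
rewrite le_eqVlt => /orP[/eqP <- _ _ _ _|ab incF dF cF' cf].
  by rewrite /Int !set_itv1 !Rintegral_set1.
have dE x : a <= x <= b -> derive1 F x = F' x.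
  by move=> /dF dFx; rewrite derive1E; exact: derive_val.
have cF x : a <= x <= b -> {for x, continuous F}.
  move=> /dF dFx; apply: differentiable_continuous; apply/derivable1_diffP.
  exact: ex_derive.
rewrite /Int /Rintegral; congr fine.
rewrite (@integration_by_substitution_increasing _ F f a b (ltW ab)).
- apply: eq_integral => x; rewrite inE/= in_itv/= => xab.
  by rewrite -(dE x xab).
- move=> x y; rewrite !in_itv/= => /andP[ax _] /andP[_ yb] xy; exact: incF.
- move=> x; rewrite in_itv/= => /andP[ax xb].
  have xab : a <= x <= b by rewrite !ltW.
  suff : derive1 F y @[y --> x] --> derive1 F x by [].
  rewrite (dE x xab).
  apply: cvg_trans (cF' x xab); apply: near_eq_cvg.
  near=> y; apply/esym/dE.
  by apply/andP; split; apply/ltW; near: y; [exact: lt_nbhsr|exact: lt_nbhsl].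
- apply/cvg_ex; exists (F' a).
  apply: cvg_trans (cvg_at_right_filter (cF' a _)); last by rewrite lexx ltW.
  apply: near_eq_cvg; near=> y; apply/esym/dE.
  by apply/andP; split; [|near: y; exact: nbhs_right_le].
- apply/cvg_ex; exists (F' b).
  apply: cvg_trans (cvg_at_left_filter (cF' b _)); last by rewrite lexx ltW.
  apply: near_eq_cvg; near=> y; apply/esym/dE.
  by apply/andP; split; [near: y; exact: nbhs_left_ge|].
- split.
  + move=> x; rewrite in_itv/= => /andP[ax xb].
    by have := dF x; rewrite !ltW// => /(_ isT) dFx; exact: ex_derive.
  + by apply: cvg_at_right_filter; apply: cF; rewrite lexx ltW.
  + by apply: cvg_at_left_filter; apply: cF; rewrite lexx ltW.
- exact: cts_within.
Unshelve. all: by end_near. Qed.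

Lemma Int_scale c b f : 0 < c -> 0 <= b -> cts 0 b f ->
  c * Int 0 b f = Int 0 (c * b) (fun v => f (v / c)).
Proof.
move=> c0 b0 cf.
have dF x : is_derive x 1 (fun v : R => c^-1 * v) c^-1.
  have := @is_deriveZ _ _ _ (@id R) c^-1 x 1 1 (is_derive_id x 1).
  by rewrite /GRing.scale/= mulr1.
have e0 : (c^-1 * 0 : R) = 0 by rewrite mulr0.
have eb : c^-1 * (c * b) = b by rewrite mulKf// gt_eqF.
have := @Int_subst 0 (c * b) f (fun v => c^-1 * v) (fun=> c^-1).
rewrite e0 eb => -> //.
- rewrite -IntZ; last first.
    move=> x /andP[x0 xcb]; apply: continuousM; last exact: cst_continuous.
    apply: (@continuous_comp _ _ _ (fun v => c^-1 * v) f).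
      by apply: continuousM => //; exact: cst_continuous.
    apply: cf; rewrite mulr_ge0 ?invr_ge0 ?(ltW c0)//=.
    by rewrite mulrC ler_pdivrMr// mulrC.
  by apply: eq_Int => x _; rewrite mulrCA mulfV ?gt_eqF// mulr1 mulrC.
- by rewrite mulr_ge0// ltW.
- by move=> x y _ xy _; rewrite ltr_pM2l ?invr_gt0.
- exact: cts_cst.
Qed.

End IntervalIntegral.

(** * The Fourier integral and its recurrences *)

Section Kernel.
Variable R : realType.
Implicit Types (m t x y : R) (n : nat) (z w : R[i]).

(** The factor x / (1 - Re r), extended by its limit 1 at 0 and to negative x
by parity so as to be continuous on a neighbourhood of the whole segment. *)
Definition weight x : R := if x == 0 then 1 else `|x| / (1 - Re (croot x)).

Definition integrand m n x : R := Re (cis (- (2 * m * x ^+ 2)) * croot x ^+ n) * weight x.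

(** The value of x at theta = pi. *)
Definition xmax : R := Num.sqrt (pi / 2).

(** The Fourier integral (1/pi) int_0^pi after the substitution theta = 2 x^2,
whose Jacobian 4 x is split between the factor 4 and [weight]. *)
Definition gker m n : R := 4 / pi * Int 0 xmax (integrand m n).

Lemma xmax_sqr : xmax ^+ 2 = pi / 2.
Proof. by rewrite sqr_sqrtr// divr_ge0 ?pi_ge0. Qed.

Lemma xmax_ge1 : 1 <= xmax.
Proof.
rewrite -(@ler_pXn2r _ 2%N) ?nnegrE ?sqrtr_ge0//.
by rewrite expr1n xmax_sqr pihalf_ge1.
Qed.

Lemma xmax_ge0 : 0 <= xmax. Proof. by rewrite sqrtr_ge0. Qed.

Lemma xmax_dom x : 0 <= x <= xmax -> x ^+ 2 < 2.
Proof.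
move=> /andP[x0 xX]; apply: le_lt_trans (pihalf_lt2 R).
by rewrite -xmax_sqr lerXn2r ?nnegrE// xmax_ge0.
Qed.

Lemma crootN x : croot (- x) = croot x :> R[i].
Proof. by rewrite /croot /phase sqrrN. Qed.

Lemma croot0 : croot 0 = 1 :> R[i].
Proof.
have := one_sub_croot_le (lexx (0 : R)); rewrite mulr0 => h.
apply/esym/eqP; rewrite -subr_eq0; apply/eqP/eq0_normc/eqP.
by rewrite eq_le h normc_ge0.
Qed.

Lemma croot_norm x : croot `|x| = croot x :> R[i].
Proof. by case: (ger0P x) => [x0|x0]; rewrite ?crootN. Qed.

Lemma Re_croot_lt1 x : x != 0 -> x ^+ 2 <= 2 -> `|x| / 10 <= 1 - Re (croot x).
Proof.
move=> xn0 x2; rewrite -croot_norm; apply: one_sub_Re_croot_ge => //.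
by rewrite real_normK ?num_real.
Qed.

Lemma weight_ge0 x : x ^+ 2 <= 2 -> 0 <= weight x.
Proof.
rewrite /weight; case: eqP => [//|/eqP xn0 x2]; apply: divr_ge0 => //.
by apply: le_trans (Re_croot_lt1 xn0 x2); rewrite divr_ge0.
Qed.

Lemma weight_le x : x ^+ 2 <= 2 -> weight x <= 10.
Proof.
rewrite /weight; case: eqP => [_ _|/eqP xn0 x2]; first by rewrite ler1n.
have x0 : 0 < `|x| by rewrite normr_gt0.
have := Re_croot_lt1 xn0 x2 => h.
rewrite ler_pdivrMr; last by lra.
by lra.
Qed.

Lemma weight_lin x : x ^+ 2 <= 2 -> `|weight x - 1| <= 160 * `|x|.
Proof.
rewrite /weight; case: eqP => [->|/eqP xn0 x2].
  by rewrite subrr !normr0 mulr0.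
have x0 : 0 < `|x| by rewrite normr_gt0.
have h := Re_croot_lt1 xn0 x2.
have d0 : 0 < 1 - Re (croot x) by lra.
have -> : `|x| / (1 - Re (croot x)) - 1 = (`|x| - (1 - Re (croot x))) / (1 - Re (croot x)).
  by field; rewrite gt_eqF.
rewrite normrM normfV (gtr0_norm d0) ler_pdivrMr//.
have := @one_sub_Re_croot_lin _ `|x| (normr_ge0 _).
rewrite real_normK ?num_real// => /(_ x2); rewrite croot_norm distrC -real_normK ?num_real// => h2.
apply: le_trans h2 _; nra.
Qed.

Lemma cont_of_bound (f : R -> R) x C : x ^+ 2 < 2 ->
  (forall y, y ^+ 2 <= 2 -> `|f x - f y| <= C * `|x - y|) -> {for x, continuous f}.
Proof.
move=> x2 H; apply/cvgrPdist_le => /= e e0.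
have C1 : 0 < `|C| + 1 by rewrite ltr_wpDl.
near=> y.
have y2 : y ^+ 2 <= 2.
  near: y.
  have c2 : {for x, continuous (fun u : R => u ^+ 2)} by exact: exprn_continuous.
  have := @cvgr_le _ _ _ _ _ _ c2 2 x2; apply.
apply: le_trans (H y y2) _.
apply: le_trans (_ : (`|C| + 1) * `|x - y| <= _).
  by rewrite ler_wpM2r// (le_trans (ler_norm _))// lerDl.
rewrite mulrC -ler_pdivlMr//.
near: y; apply: (@cvgr_dist_le _ _ _ _ (nbhs_filter x) id x); first exact: cvg_id.
by rewrite divr_gt0.
Unshelve. all: by end_near. Qed.

Lemma crootX_lip n x y : x ^+ 2 <= 2 -> y ^+ 2 <= 2 ->
  normc (croot x ^+ n - croot y ^+ n) <= n%:R * 40 * `|x - y|.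
Proof.
move=> x2 y2; apply: le_trans (normcBX _ (croot_le1 x) (croot_le1 y)) _.
rewrite expr1n mulr1 -mulrA ler_wpM2l// -(croot_norm x) -(croot_norm y).
apply: le_trans (croot_lipschitz _ _ _ _) _ => //; rewrite ?real_normK ?num_real//.
by rewrite ler_wpM2l// ler_dist_dist.
Qed.

Lemma Re_crootX_cont n x : x ^+ 2 < 2 -> {for x, continuous (fun x => Re (croot x ^+ n))}.
Proof.
move=> x2; apply: (@cont_of_bound _ _ (n%:R * 40) x2) => y y2.
apply: le_trans (crootX_lip n (ltW x2) y2).
by rewrite -ReN -ReD Re_le_normc.
Qed.

Lemma Im_crootX_cont n x : x ^+ 2 < 2 -> {for x, continuous (fun x => Im (croot x ^+ n))}.
Proof.
move=> x2; apply: (@cont_of_bound _ _ (n%:R * 40) x2) => y y2.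
apply: le_trans (crootX_lip n (ltW x2) y2).
by apply: le_trans (Im_le_normc _); case: (croot x ^+ n) (croot y ^+ n) => [a b] [c d].
Qed.

Lemma weight_cont x : x ^+ 2 < 2 -> {for x, continuous weight}.
Proof.
move=> x2; have [x0|xn0] := eqVneq x 0.
  apply: (@cont_of_bound _ _ 160 x2) => y y2.
  rewrite x0 sub0r normrN distrC {2}/weight eqxx; exact: weight_lin.
have cN : {for x, continuous (fun x => `|x| / (1 - Re (croot x ^+ 1)))}.
  apply: continuousM; first exact: norm_continuous.
  apply: continuousV.
    rewrite expr1; have h := Re_croot_lt1 xn0 (ltW x2).
    by rewrite gt_eqF// (lt_le_trans _ h)// divr_gt0// normr_gt0.
  apply: continuousB; first exact: cst_continuous.
  exact: Re_crootX_cont.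
have pE : weight x = `|x| / (1 - Re (croot x ^+ 1)) by rewrite /weight (negbTE xn0) expr1.
suff : weight y @[y --> x] --> weight x by [].
rewrite pE.
have nz : \forall y \near x, y != 0 by apply: open_nbhs_nbhs; split => //; exact: open_neq.
have eqn : \forall y \near x, `|y| / (1 - Re (croot y ^+ 1)) = weight y.
  by near=> y; rewrite /weight expr1 ifF//; apply/negbTE; near: y.
apply: cvg_trans cN; exact: near_eq_cvg eqn.
Unshelve. all: by end_near. Qed.

Lemma trig_cont (g : R -> R) c x : continuous g -> {for x, continuous (fun x => g (c * x ^+ 2))}.
Proof.
move=> cg; apply: (@continuous_comp _ _ _ (fun x : R => c * x ^+ 2) g); last exact: cg.
by apply: continuousM; [exact: cst_continuous|exact: exprn_continuous].
Qed.

Lemma integrandE m n x : integrand m n x =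
  (cos (2 * m * x ^+ 2) * Re (croot x ^+ n) + sin (2 * m * x ^+ 2) * Im (croot x ^+ n)) * weight x.
Proof. by rewrite /integrand ReM /= cosN sinN mulNr opprK. Qed.

Lemma integrand_cont m n x : x ^+ 2 < 2 -> {for x, continuous (integrand m n)}.
Proof.
move=> x2; rewrite (_ : integrand m n = (fun x => (cos (2 * m * x ^+ 2) * Re (croot x ^+ n)
  + sin (2 * m * x ^+ 2) * Im (croot x ^+ n)) * weight x)); last first.
  by apply/funext => y; exact: integrandE.
apply: continuousM; last exact: weight_cont.
apply: continuousD; apply: continuousM.
- exact: trig_cont (@continuous_cos R).
- exact: Re_crootX_cont.
- exact: trig_cont (@continuous_sin R).
- exact: Im_crootX_cont.
Qed.

Lemma integrand_cts m n a b : 0 <= a -> b ^+ 2 < 2 -> cts a b (integrand m n).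
Proof.
move=> a0 b2 x /andP[ax xb]; apply: integrand_cont; apply: le_lt_trans b2.
by rewrite lerXn2r ?nnegrE// (le_trans a0)// (le_trans ax).
Qed.

Lemma xmax_lt2 : xmax ^+ 2 < 2.
Proof. by rewrite xmax_sqr pihalf_lt2. Qed.

Lemma integrand_le m n x : 0 <= x -> x ^+ 2 <= 2 -> `|integrand m n x| <= 10 * (1 - x / 10) ^+ n.
Proof.
move=> x0 x2; rewrite /integrand normrM (ger0_norm (weight_ge0 x2)) mulrC.
apply: ler_pM => //; [exact: weight_ge0|exact: weight_le|].
apply: le_trans (Re_le_normc _) _; rewrite normcM normc_cis mul1r normcX.
apply: lerXn2r; rewrite ?nnegrE ?normc_ge0//.
  by have := one_sub_croot_ge x0 x2; have := normc_ge0 (croot x); lra.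
by have := one_sub_croot_ge x0 x2; lra.
Qed.

Lemma integrand_le10 m n x : 0 <= x -> x ^+ 2 <= 2 -> `|integrand m n x| <= 10.
Proof.
move=> x0 x2; apply: le_trans (integrand_le m n x0 x2) _.
rewrite ler_piMr// exprn_ile1//; first by nra.
by rewrite lerBlDr lerDl divr_ge0.
Qed.

(** The characteristic equation times r^n e^(-i m theta). *)
Lemma integrand_rec m n x :
  3 * integrand m n.+1 x = integrand m n x + integrand m n.+2 x + integrand (m - 1) n.+1 x.
Proof.
rewrite /integrand -!mulrDl mulrA; congr (_ * _).
have -> : cis (- (2 * (m - 1) * x ^+ 2)) = cis (- (2 * m * x ^+ 2)) * phase x.
  by rewrite /phase -cisD; congr cis; ring.
set c := cis (- (2 * m * x ^+ 2)); rewrite -!ReD.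
transitivity (Re (c * croot x ^+ n.+1 + c * croot x ^+ n.+1 + c * croot x ^+ n.+1)).
  by rewrite !ReD; ring.
congr Re; apply/eqP; rewrite -subr_eq0; apply/eqP.
transitivity (- c * croot x ^+ n * (croot x ^+ 2 - (3 - phase x) * croot x + 1)).
  by rewrite !exprS expr0; ring.
by rewrite crootE mulr0.
Qed.

(** The two neighbours of an axis vertex contribute Re (e^(-i m theta) r) and
Re (e^(i m theta) r), whose sum is 2 cos (m theta) Re r: this is why the
denominator is 1 - Re r. *)
Lemma integrand_axis m x : x ^+ 2 <= 2 ->
  integrand m 0 x = cos (2 * m * x ^+ 2) * `|x| + (integrand m 1 x + integrand (- m) 1 x) / 2.
Proof.
move=> x2.
have -> : (integrand m 1 x + integrand (- m) 1 x) / 2 = cos (2 * m * x ^+ 2) * Re (croot x) * weight x.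
  rewrite !integrandE !expr1.
  have -> : 2 * - m * x ^+ 2 = - (2 * m * x ^+ 2) by ring.
  by rewrite cosN sinN; field.
rewrite integrandE expr0 /= mulr1 mulr0 addr0.
have -> : `|x| = (1 - Re (croot x)) * weight x.
  rewrite /weight; have [->|xn0] := eqVneq x 0; first by rewrite croot0 normr0 /= subrr mul0r.
  rewrite mulrC divfK// gt_eqF// (lt_le_trans _ (Re_croot_lt1 xn0 x2))//.
  by rewrite divr_gt0 ?normr_gt0.
ring.
Qed.

Lemma is_derive_sqr c x : is_derive x 1 (fun x : R => c * x ^+ 2) (2 * c * x).
Proof.
apply: is_derive_eq; rewrite /GRing.scale/= !mulr1; ring.
Qed.

Lemma is_derive_sin_sqr c x :
  is_derive x 1 (fun x : R => sin (c * x ^+ 2)) (2 * c * x * cos (c * x ^+ 2)).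
Proof.
have h := is_derive_sqr c x.
have k := @is_derive1_comp _ sin (fun x : R => c * x ^+ 2) x _ _
  (is_derive_sin (c * x ^+ 2)) h.
apply: (@is_derive_eq _ _ _ _ _ _ _ _ k).
by rewrite mulrC.
Qed.

Lemma sin_int_pi (k : int) : sin (k%:~R * pi : R) = 0.
Proof.
have H (j : nat) : sin (j%:R * pi : R) = 0.
  elim: j => [|j IH]; first by rewrite mul0r sin0.
  by rewrite -natr1 mulrDl mul1r sinDpi IH oppr0.
case: k => j; first exact: H.
by rewrite NegzE rmorphN mulNr sinN H oppr0.
Qed.

(** Orthogonality of the characters of the circle, in the variable x; it
produces the point mass at the source. *)
Lemma Int_cos_axis (k : int) :
  4 / pi * Int 0 xmax (fun x => cos (2 * k%:~R * x ^+ 2) * `|x|) = (k == 0)%:R.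
Proof.
have pi0 : (pi : R) != 0 by rewrite gt_eqF ?pi_gt0.
have -> : Int 0 xmax (fun x => cos (2 * k%:~R * x ^+ 2) * `|x|) =
          Int 0 xmax (fun x => cos (2 * k%:~R * x ^+ 2) * x).
  by apply: eq_Int => x /andP[x0 _]; rewrite ger0_norm.
have cc c : cts 0 xmax (fun x => cos (c * x ^+ 2) * x).
  move=> x _; apply: continuousM; first exact: trig_cont (@continuous_cos R).
  by [].
have [->|kn0] := eqVneq k 0.
  transitivity (4 / pi * (2^-1 * xmax ^+ 2 - 2^-1 * 0 ^+ 2) : R).
    congr (_ * _); apply: (@Int_FTC _ _ _ _ (fun x => 2^-1 * x ^+ 2)) => //.
      exact: xmax_ge0.
    move=> x _; have hd := is_derive_sqr (2^-1 : R) x.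
    apply: (@is_derive_eq _ _ _ _ _ _ _ _ hd).
    by rewrite mulr0 mul0r cos0; field.
  rewrite expr0n mulr0 subr0 xmax_sqr; transitivity (1 : R); last by [].
  by move: pi0; generalize (pi : R) => p p0; field.
set K : R := k%:~R.
have K0 : K != 0 by rewrite intr_eq0.
transitivity (4 / pi * ((4 * K)^-1 * sin (2 * K * xmax ^+ 2) - (4 * K)^-1 * sin (2 * K * 0 ^+ 2)) : R).
  congr (_ * _); apply: (@Int_FTC _ _ _ _ (fun x => (4 * K)^-1 * sin (2 * K * x ^+ 2))) => //.
    exact: xmax_ge0.
  move=> x _; have hd := @is_deriveZ _ _ _ (fun x : R => sin (2 * K * x ^+ 2)) (4 * K)^-1 x 1 _
    (is_derive_sin_sqr (2 * K) x).
  apply: (@is_derive_eq _ _ _ _ _ _ _ _ hd).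
  by rewrite /GRing.scale/=; field.
rewrite expr0n mulr0 sin0 mulr0 subr0 xmax_sqr.
have -> : 2 * K * (pi / 2) = K * pi by field.
by rewrite sin_int_pi !mulr0.
Qed.

Lemma gker_rec m n : 3 * gker m n.+1 = gker m n + gker m n.+2 + gker (m - 1) n.+1.
Proof.
have C m' n' : cts 0 xmax (integrand m' n') by apply: integrand_cts => //; exact: xmax_lt2.
rewrite /gker -!mulrDr mulrCA; congr (_ * _).
rewrite -IntZ// -IntD// -IntD//; last exact: ctsD.
by apply: eq_Int => x _; exact: integrand_rec.
Qed.

Lemma gker_axis (k : int) :
  gker k%:~R 0 = (k == 0)%:R + (gker k%:~R 1 + gker (- k%:~R) 1) / 2.
Proof.
have C m' n' : cts 0 xmax (integrand m' n') by apply: integrand_cts => //; exact: xmax_lt2.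
have Cc : cts 0 xmax (fun x => cos (2 * k%:~R * x ^+ 2) * `|x|).
  move=> x _; apply: continuousM; first exact: trig_cont (@continuous_cos R).
  exact: norm_continuous.
rewrite -Int_cos_axis /gker.
transitivity (4 / pi * (Int 0 xmax (fun x => cos (2 * k%:~R * x ^+ 2) * `|x|)
  + 2^-1 * (Int 0 xmax (integrand k%:~R 1) + Int 0 xmax (integrand (- k%:~R) 1)))); last first.
  by rewrite !mulrDr [_ / 2]mulrC !mulrDr !(mulrCA 2^-1).
congr (_ * _); rewrite -IntD// -IntZ; last exact: ctsD.
rewrite -IntD//; last by apply: ctsM; [exact: cts_cst|exact: ctsD].
apply: eq_Int => x xX; rewrite integrand_axis; last exact/ltW/xmax_dom.
by rewrite [_ / 2]mulrC.
Qed.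

End Kernel.

(** * Uniform decay of the Fourier integral *)

Section KernelBounds.
Variable R : realType.
Implicit Types (m t x y h a : R) (n : nat) (z w : R[i]).

Lemma is_derive_exp n x : is_derive x 1 (fun u : R => u ^+ n.+1) (n.+1%:R * x ^+ n).
Proof.
have := @is_deriveX R R id n.+1 x 1 1 (is_derive_id _ _).
by rewrite exprfctE /GRing.scale/= mulr1.
Qed.

(** Each of the n + 1 terms of the geometric sum of the (1 - y)^k y is at least
the last one, and the sum is at most 1. *)
Lemma pow_decay n y : 0 <= y <= 1 -> n.+1%:R * (1 - y) ^+ n * y <= 1.
Proof.
move=> /andP[y0 y1]; apply: (@le_trans _ _ (1 - (1 - y) ^+ n.+1)); last first.
  by rewrite lerBlDr lerDl exprn_ge0// subr_ge0.
elim: n => [|n IH]; first by rewrite expr0 expr1; lra.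
have p1 : (1 - y) ^+ n.+1 <= 1 by rewrite exprn_ile1 ?subr_ge0// lerBlDr lerDl.
have H : (1 - y) * (n.+1%:R * (1 - y) ^+ n * y) <= (1 - y) * (1 - (1 - y) ^+ n.+1).
  by rewrite ler_wpM2l// subr_ge0.
have -> : n.+2%:R * (1 - y) ^+ n.+1 * y =
   (1 - y) * (n.+1%:R * (1 - y) ^+ n * y) + (1 - y) ^+ n.+1 * y.
  by rewrite -[n.+2%:R]natr1 [(1 - y) ^+ n.+1]exprS; ring.
apply: le_trans (lerD H (lexx _)) _.
rewrite [(1 - y) ^+ n.+2]exprS; nra.
Qed.

Lemma inv4pi_le2 : 4 / pi <= 2 :> R.
Proof. by rewrite ler_pdivrMr ?pi_gt0//; have := pi_ge2 R; lra. Qed.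

Lemma inv4pi_gt0 : 0 < 4 / pi :> R.
Proof. by rewrite divr_gt0 ?pi_gt0. Qed.

Lemma xmax_lt : @xmax R < 3 / 2.
Proof.
have := xmax_lt2 R; have := xmax_ge0 R; nra.
Qed.

Lemma integrand_tail_pow m n a : 0 <= a -> a <= xmax R ->
  `|Int a (xmax R) (integrand m n)| <= 100 / n.+1%:R * (1 - a / 10) ^+ n.+1.
Proof.
move=> a0 aX; have n0 : 0 < n.+1%:R :> R by rewrite ltr0n.
pose F x := - (100 / n.+1%:R) * (1 - x / 10) ^+ n.+1.
have cp : cts a (xmax R) (fun x => 10 * (1 - x / 10) ^+ n).
  move=> x _; apply: continuousM; first exact: cst_continuous.
  apply: (@continuous_comp _ _ _ (fun x : R => 1 - x / 10) (fun x : R => x ^+ n)); last exact: exprn_continuous.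
  apply: continuousB; first exact: cst_continuous.
  by apply: continuousM => //; exact: cst_continuous.
apply: (@le_trans _ _ (Int a (xmax R) (fun x => 10 * (1 - x / 10) ^+ n))).
  apply: norm_Int_le => //; first by apply: integrand_cts => //; exact: xmax_lt2.
  move=> x /andP[ax xX]; apply: integrand_le; first exact: le_trans ax.
  by apply/ltW; apply: (@xmax_dom R); rewrite xX andbT (le_trans a0).
rewrite (_ : Int _ _ _ = F (xmax R) - F a); last first.
  apply: (@Int_FTC _ _ _ _ F); [exact: aX|exact: cp|].
  move=> x _.
  have d1 : is_derive x 1 (fun x : R => 1 - x / 10) (- 10^-1).
    by apply: is_derive_eq; rewrite /GRing.scale/=; ring.
  have d0 : is_derive (1 - x / 10) 1 (fun u : R => u ^+ n.+1) (n.+1%:R * (1 - x / 10) ^+ n).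
    exact: is_derive_exp.
  have d2 := @is_derive1_comp _ (fun u : R => u ^+ n.+1) (fun x : R => 1 - x / 10) x _ _ d0 d1.
  have d3 := @is_deriveZ _ _ _ _ (- (100 / n.+1%:R)) x 1 _ d2.
  apply: (@is_derive_eq _ _ _ _ _ _ _ _ d3).
  rewrite /GRing.scale/=.
  move: n0; generalize (n.+1%:R : R) => N N0; generalize ((1 - x / 10) ^+ n) => q.
  by field; rewrite gt_eqF.
rewrite /F !mulNr opprK gerDr oppr_le0 mulr_ge0 ?divr_ge0 ?ler0n// exprn_ge0//.
by have := xmax_lt; lra.
Qed.

Lemma gker_le_inv m n : `|gker m n| <= 200 / n.+1%:R.
Proof.
rewrite /gker normrM (gtr0_norm inv4pi_gt0).
have := integrand_tail_pow m n (lexx 0) (xmax_ge0 R).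
rewrite mul0r subr0 expr1n mulr1 => H.
have := inv4pi_le2; have := inv4pi_gt0; move: (4 / pi) => c c0 c2.
apply: le_trans (_ : 2 * (100 / n.+1%:R) <= _); last by rewrite mulrA -natrM.
by apply: ler_pM => //; exact: ltW.
Qed.

Lemma sqr_le x y : 0 <= x -> x <= y -> x ^+ 2 <= y ^+ 2.
Proof. by move=> x0 xy; rewrite lerXn2r ?nnegrE// (le_trans x0). Qed.

Lemma crootX_shift n x y : 0 < x -> x <= y -> y ^+ 2 <= 2 ->
  normc (croot x ^+ n - croot y ^+ n) <= 200 * (y ^+ 2 - x ^+ 2) / x ^+ 2.
Proof.
move=> x0 xy y2; have y0 : 0 < y by exact: lt_le_trans xy.
have x2 : x ^+ 2 <= 2 by apply: le_trans y2; apply: sqr_le => //; exact: ltW.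
have xylt : x ^+ 2 <= y ^+ 2 by apply: sqr_le => //; exact: ltW.
case: n => [|n].
  rewrite (expr0 (croot x)) (expr0 (croot y)) subrr normc0.
  by apply: divr_ge0; [apply: mulr_ge0; [exact: ler0n|rewrite subr_ge0]|exact: sqr_ge0].
have rx : normc (croot x) <= 1 - x / 10 by have := one_sub_croot_ge (ltW x0) x2; lra.
have ry : normc (croot y) <= 1 - x / 10 by have := one_sub_croot_ge (ltW y0) y2; lra.
apply: le_trans (normcBX _ rx ry) _ => /=.
have h1 : normc (croot x - croot y) <= 20 * (y ^+ 2 - x ^+ 2) / x.
  apply: le_trans (croot_lip y x0 x2) _.
  by rewrite distrC ger0_norm// subr_ge0.
have h2 : n.+1%:R * (1 - x / 10) ^+ n <= 10 / x.
  have x2' : x <= 2 by nra.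
  have x10 : 0 <= x / 10 <= 1 by lra.
  have := pow_decay n x10; rewrite ler_pdivlMr//.
  by move: (n.+1%:R * _) => P; lra.
apply: le_trans (_ : 10 / x * (20 * (y ^+ 2 - x ^+ 2) / x) <= _).
  by apply: ler_pM => //; rewrite ?normc_ge0// mulr_ge0// exprn_ge0//; nra.
rewrite le_eqVlt; apply/orP; left; apply/eqP; field.
by rewrite gt_eqF.
Qed.

(** The translation theta -> theta + 2 h, read in the variable x. *)
Definition tau h x : R := Num.sqrt (x ^+ 2 + h).

Lemma tau_sqr h x : 0 <= h -> tau h x ^+ 2 = x ^+ 2 + h.
Proof. by move=> h0; rewrite sqr_sqrtr// addr_ge0 ?sqr_ge0. Qed.

Lemma tau_ge h x : 0 <= h -> 0 <= x -> x <= tau h x.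
Proof.
move=> h0 x0; rewrite -(@ler_pXn2r _ 2%N) ?nnegrE ?sqrtr_ge0// tau_sqr//.
by rewrite lerDl.
Qed.

Lemma is_derive_tau h x : 0 <= h -> 0 < x -> is_derive x 1 (tau h) (x / tau h x).
Proof.
move=> h0 x0.
have g0 : 0 < x ^+ 2 + h by rewrite ltr_pwDl ?exprn_gt0.
have d1 : is_derive x 1 (fun x : R => x ^+ 2 + h) (2 * x).
  have := @is_deriveD _ _ _ (fun u : R => u ^+ 2) (fun=> h) x 1 _ _ (is_derive_exp 1 x)
    (is_derive_cst h x 1).
  by rewrite expr1 addr0.
have hd := @is_derive1_comp _ Num.sqrt _ x _ _ (is_derive1_sqrt g0) d1.
apply: (@is_derive_eq _ _ _ _ _ _ _ _ hd); rewrite /tau.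
have : Num.sqrt (x ^+ 2 + h) != 0 by rewrite sqrtr_eq0 -ltNge.
by move: (Num.sqrt _) => s s0; field.
Qed.

(** When 2 m h is an odd multiple of pi the translation changes the sign of the
oscillating factor, so only the variation of r^n and of 1 / (1 - Re r) is
left.  The factor n in the variation of r^n is absorbed by the decay
(1 - x/10)^(n-1) ([pow_decay]), so the bound does not depend on n. *)
Lemma integrand_shift m n h x : cis (2 * m * h) = -1 :> R[i] -> 0 < h -> 0 < x ->
  x ^+ 2 + h <= 2 ->
  `|integrand m n x + integrand m n (tau h x) * (x / tau h x)| <= 40 * 100 * h * x ^- 2.
Proof.
move=> ch h0 x0 y2; set y := tau h x.
have yE : y ^+ 2 = x ^+ 2 + h by rewrite tau_sqr ?ltW.
have xy : x <= y by rewrite tau_ge ?ltW.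
have y0 : 0 < y by exact: lt_le_trans xy.
have x2 : x ^+ 2 <= 2 by lra.
have {}y2 : y ^+ 2 <= 2 by rewrite yE.
(* the oscillating factor at y is opposite to the one at x *)
have cE : cis (- (2 * m * y ^+ 2)) = - cis (- (2 * m * x ^+ 2)).
  apply/eqP; rewrite -subr_eq0 opprK; apply/eqP.
  have -> : - (2 * m * x ^+ 2) = - (2 * m * y ^+ 2) + 2 * m * h by rewrite yE; ring.
  by rewrite cisD ch; ring.
set c := cis (- (2 * m * x ^+ 2)) in cE.
have gx : x / 10 <= 1 - Re (croot x) by exact: one_sub_Re_croot_ge (ltW x0) x2.
have gy : x / 10 <= 1 - Re (croot y).
  apply: le_trans (one_sub_Re_croot_ge (ltW y0) y2); lra.
set dx := 1 - Re (croot x) in gx; set dy := 1 - Re (croot y) in gy.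
have dx0 : 0 < dx by lra.
have dy0 : 0 < dy by lra.
have -> : integrand m n x + integrand m n y * (x / y) =
   x * (Re (c * (croot x ^+ n - croot y ^+ n)) / dy + Re (c * croot x ^+ n) * (dy - dx) / (dx * dy)).
  rewrite /integrand cE -/c /weight (gt_eqF x0) (gt_eqF y0) (gtr0_norm x0) (gtr0_norm y0) -/dx -/dy.
  rewrite mulrBr ReD ReN mulNr ReN; field.
  by rewrite (gt_eqF dx0) (gt_eqF dy0) (gt_eqF y0).
have b1 := crootX_shift n x0 xy y2.
rewrite yE (_ : x ^+ 2 + h - x ^+ 2 = h) in b1; last by ring.
have n1 : `|Re (c * (croot x ^+ n - croot y ^+ n))| <= 200 * h * x ^- 2.
  apply: le_trans (Re_le_normc _) _; by rewrite normcM normc_cis mul1r.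
have n2 : `|Re (c * croot x ^+ n)| <= 1.
  apply: le_trans (Re_le_normc _) _; rewrite normcM normc_cis mul1r normcX.
  by rewrite exprn_ile1 ?normc_ge0 ?croot_le1.
have n3 : `|dy - dx| <= 20 * h / x.
  rewrite (_ : dy - dx = Re (croot x - croot y)); last by rewrite ReD ReN /dx /dy; ring.
  apply: le_trans (Re_le_normc _) _; apply: le_trans (croot_lip y x0 x2) _.
  by rewrite yE (_ : x ^+ 2 - _ = - h) ?normrN ?gtr0_norm//; ring.
have ix : dx^-1 <= 10 / x.
  by rewrite -[10 / x]invf_div lef_pV2 ?posrE// divr_gt0.
have iy : dy^-1 <= 10 / x.
  by rewrite -[10 / x]invf_div lef_pV2 ?posrE// divr_gt0.
rewrite normrM (gtr0_norm x0).
apply: (@le_trans _ _ (x * (200 * h * x ^- 2 * (10 / x) + 1 * (20 * h / x) * ((10 / x) * (10 / x))))).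
  rewrite ler_wpM2l ?(ltW x0)//; apply: le_trans (ler_normD _ _) _; apply: lerD.
    rewrite normrM normfV (gtr0_norm dy0); apply: ler_pM => //.
    by rewrite invr_ge0 ltW.
  rewrite !normrM normfV normrM (gtr0_norm dx0) (gtr0_norm dy0) invfM.
  apply: ler_pM.
  - by apply: mulr_ge0; exact: normr_ge0.
  - by apply: mulr_ge0; rewrite invr_ge0 ltW.
  - by apply: ler_pM => //; exact: normr_ge0.
  - by apply: ler_pM => //; rewrite invr_ge0 ltW.
rewrite le_eqVlt; apply/orP; left; apply/eqP; field.
by rewrite gt_eqF.
Qed.

Lemma cis_pi : cis pi = -1 :> R[i].
Proof. by rewrite -[pi]add0r cispi cis0. Qed.

Lemma cis_Npi : cis (- pi) = -1 :> R[i].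
Proof. by rewrite -[LHS]opprK -cispi addNr cis0. Qed.

Lemma Int_inv_sqr a b c : 0 < a -> a <= b -> 0 <= c ->
  Int a b (fun x => c * x ^- 2) <= c / a.
Proof.
move=> a0 ab c0.
have cV : cts a b (fun x => x ^- 2).
  move=> x /andP[ax _]; apply: continuousV; last exact: exprn_continuous.
  by rewrite expf_neq0// gt_eqF// (lt_le_trans a0).
rewrite IntZ// ler_wpM2l//.
rewrite (_ : Int a b _ = (- b^-1) - (- a^-1)); last first.
  apply: (@Int_FTC _ _ _ _ (fun x => - x^-1)) => //.
  move=> x /andP[ax _]; have x0 : x != 0 by rewrite gt_eqF// (lt_le_trans a0).
  have h1 := @is_deriveV R (@id R) x 1 1 x0 (is_derive_id x 1).
  have h2 := @is_deriveN _ _ _ _ x 1 _ h1.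
  apply: (@is_derive_eq _ _ _ _ _ _ _ _ h2).
  by rewrite /GRing.scale/= mulr1 opprK.
by rewrite opprK gerDr oppr_le0 invr_ge0 (le_trans (ltW a0)).
Qed.

(** The tail is half the sum of itself and of its translate, up to two short
boundary pieces of length at most h / a. *)
Lemma integrand_tail_shift m n h a : cis (2 * m * h) = -1 :> R[i] -> 0 < h ->
  @xmax R ^+ 2 + h < 2 -> 0 < a -> a <= xmax R ->
  `|Int a (xmax R) (integrand m n)| <= 21 * 100 * h / a.
Proof.
move=> ch h0 hX a0 aX; set X := xmax R in hX aX *; set g := integrand m n.
have X1 : 1 <= X by exact: xmax_ge1.
have X0 : 0 < X by lra.
have hle : 0 <= h by exact: ltW.
have tX2 : tau h X ^+ 2 < 2 by rewrite tau_sqr.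
have ta : a <= tau h a by rewrite tau_ge// ltW.
have tX : X <= tau h X by rewrite tau_ge// ltW.
have tau_incr x y : a <= x -> x < y -> y <= X -> tau h x < tau h y.
  move=> ax xy yX; rewrite /tau ltr_sqrt ?ltrD2r.
    by rewrite ltrXn2r ?nnegrE//; lra.
  by rewrite ltr_wpDr// exprn_gt0//; lra.
have taX : tau h a <= tau h X.
  by rewrite /tau ler_sqrt ?lerD2r ?addr_ge0 ?sqr_ge0//; apply: sqr_le => //; exact: ltW.
have cg : cts a (tau h X) g by apply: integrand_cts => //; exact: ltW.
have cF' : cts a X (fun x => x / tau h x).
  move=> x /andP[ax xX]; have x0 : 0 < x by exact: lt_le_trans ax.
  apply: continuousM => //; apply: continuousV.
    by rewrite gt_eqF// (lt_le_trans x0)// tau_ge// ltW.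
  have hd := is_derive_tau hle x0.
  by apply: differentiable_continuous; apply/derivable1_diffP; exact: ex_derive.
have cgt : cts a X (fun x => g (tau h x)).
  move=> x /andP[ax xX]; have x0 : 0 < x by exact: lt_le_trans ax.
  apply: (@continuous_comp _ _ _ (tau h) g).
    have hd := is_derive_tau hle x0.
    by apply: differentiable_continuous; apply/derivable1_diffP; exact: ex_derive.
  apply: cg; apply/andP; split.
    by apply: le_trans ax _; rewrite tau_ge// ltW.
  rewrite /tau ler_sqrt ?lerD2r ?addr_ge0 ?sqr_ge0//; apply: sqr_le => //; exact: ltW.
have short b : a <= b -> b <= X -> `|Int b (tau h b) g| <= 10 * h / b.
  move=> ab bX; have b0 : 0 < b by exact: lt_le_trans ab.
  have tb : b <= tau h b by rewrite tau_ge// ltW.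
  have tbX : tau h b <= tau h X.
    by rewrite /tau ler_sqrt ?lerD2r ?addr_ge0 ?sqr_ge0//; apply: sqr_le => //; exact: ltW.
  apply: (@le_trans _ _ (Int b (tau h b) (fun=> 10))).
    apply: norm_Int_le; [exact: cts_sub cg _ _|exact: cts_cst|].
    move=> x /andP[bx xb]; apply: integrand_le10; first by lra.
    apply/ltW; apply: le_lt_trans tX2; apply: sqr_le; first by lra.
    exact: le_trans xb _.
  rewrite Int_cst// -mulrA ler_wpM2l// ler_pdivlMr//.
  have := tau_sqr b hle; nra.
have s3 : `|Int X (tau h X) g| <= 20 * h / a.
  apply: le_trans (short X aX (lexx _)) _.
  rewrite ler_pdivrMr// mulrAC ler_pdivlMr//.
  have := xmax_lt; rewrite -/X => X32; nra.
have s2 := short a (lexx _) aX.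
have sub := @Int_subst _ a X g (tau h) (fun x => x / tau h x) aX tau_incr.
have {}sub : Int (tau h a) (tau h X) g = Int a X (fun x => g (tau h x) * (x / tau h x)).
  apply: sub => //; last exact: cts_sub cg _ _.
  by move=> x /andP[ax xX]; apply: is_derive_tau => //; exact: lt_le_trans ax.
have e1 := Int_split ta taX cg.
have e2 := Int_split aX tX cg.
have cga : cts a X g by exact: cts_sub cg _ _.
have s1 : `|Int a X g + Int (tau h a) (tau h X) g| <= 40 * 100 * h / a.
  rewrite sub -IntD//; last exact: ctsM.
  have c0 : 0 <= 40 * 100 * h by apply: mulr_ge0; [rewrite mulr_ge0 ?ler0n|exact: ltW].
  apply: le_trans (Int_inv_sqr a0 aX c0).
  apply: norm_Int_le.
  - by apply: ctsD => //; exact: ctsM.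
  - move=> x /andP[ax _]; apply: continuousM; first exact: cst_continuous.
    apply: continuousV; last exact: exprn_continuous.
    by rewrite expf_neq0// gt_eqF// (lt_le_trans a0).
  - move=> x /andP[ax xX]; have x0 : 0 < x by exact: lt_le_trans ax.
    apply: integrand_shift => //; apply/ltW; apply: le_lt_trans hX.
    by rewrite lerD2r; apply: sqr_le => //; exact: ltW.
have e3 : Int a X g + Int X (tau h X) g =
  Int a (tau h a) g + Int (tau h a) (tau h X) g by exact: (etrans (esym e2) e1).
have ha : 0 <= h / a by rewrite divr_ge0 ?ltW.
rewrite -!mulrA in s1 s2 s3 *.
clear -ha s1 s2 s3 e3; move: ha s1 s2 s3 e3.
move: (h / a) (Int a X g) (Int X _ g) (Int a (tau h a) g) (Int (tau h a) _ g).
move=> q I1 I2 I3 I4 q0 s1 s2 s3 e3.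
have -> : I1 = 2^-1 * ((I1 + I4) + I3 - I2) by lra.
rewrite normrM ger0_norm ?invr_ge0//.
have := ler_normB (I1 + I4 + I3) I2.
have := ler_normD (I1 + I4) I3.
by lra.
Qed.

(** The shift h = pi / (2 |m|) must keep x^2 below 2; the m for which
it does not form a bounded set, where the integrand being at most 10 is enough. *)
Lemma integrand_tail : exists C, 0 < C /\ forall m n a, m != 0 -> 0 < a -> a <= xmax R ->
  `|Int a (xmax R) (integrand m n)| <= C / (`|m| * a).
Proof.
pose d : R := 2 - xmax R ^+ 2.
have d0 : 0 < d by rewrite /d; have := xmax_lt2 R; lra.
exists (42 * 100 + 45 / d); split.
  by rewrite ltr_pwDl ?mulr_gt0 ?ltr0n// divr_ge0 ?ler0n// ltW.
move=> m n a m0 a0 aX.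
have nm : 0 < `|m| by rewrite normr_gt0.
pose h : R := pi / (2 * `|m|).
have h0 : 0 < h by rewrite divr_gt0 ?pi_gt0// mulr_gt0.
have hm : h <= 2 / `|m|.
  rewrite /h invfM mulrA ler_pM2r ?invr_gt0//; exact/ltW/pihalf_lt2.
have ma0 : 0 < `|m| * a by exact: mulr_gt0.
have [hX|hX] := ltP (xmax R ^+ 2 + h) 2.
  have ch : cis (2 * m * h) = -1 :> R[i].
    case: (ltrgt0P m) m0 => [mp|mn|//] _.
      rewrite (_ : 2 * m * h = pi) ?cis_pi//.
      rewrite /h gtr0_norm//; move: (gt_eqF mp) => mn.
      by generalize (pi : R) => p; field; rewrite mn.
    rewrite (_ : 2 * m * h = - pi) ?cis_Npi//.
    rewrite /h ltr0_norm//; move: (lt_eqF mn) => mn'.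
    by generalize (pi : R) => p; field; rewrite mn'.
  apply: le_trans (integrand_tail_shift n ch h0 hX a0 aX) _.
  rewrite [X in _ <= X](_ : _ = (42 * 100 + 45 / d) / `|m| / a); last first.
    by rewrite -mulrA -invfM.
  clearbody h; apply: ler_pM => //.
  - by apply: mulr_ge0; [|exact: ltW]; rewrite mulr_ge0 ?ler0n.
  - by rewrite invr_ge0 ltW.
  - apply: (@le_trans _ _ (42 * 100 / `|m|)); last first.
      by rewrite ler_pM2r ?invr_gt0// lerDl divr_ge0 ?ler0n// ltW.
    rewrite (_ : 42 * 100 / `|m| = 21 * 100 * (2 / `|m|)); last by lra.
    by rewrite ler_wpM2l ?mulr_ge0 ?ler0n.
apply: (@le_trans _ _ 15).
  apply: (@le_trans _ _ (Int a (xmax R) (fun=> 10))).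
    apply: norm_Int_le; [apply: integrand_cts; [exact: ltW|exact: xmax_lt2]|exact: cts_cst|].
    move=> x /andP[ax xX]; apply: integrand_le10; first by lra.
    by apply/ltW; apply: (@xmax_dom R); rewrite xX andbT; lra.
  by rewrite Int_cst//; have := xmax_lt; lra.
rewrite ler_pdivlMr//.
have : d <= 2 / `|m| by rewrite /d; lra.
rewrite ler_pdivlMr// => dm.
have a32 : a <= 3 / 2 by have := xmax_lt; lra.
have dma : `|m| * a <= 3 / d.
  rewrite ler_pdivlMr//; nra.
have : 0 <= 45 / d - 15 * (3 / d) by rewrite le_eqVlt; apply/orP; left; apply/eqP; field; rewrite gt_eqF.
by lra.
Qed.

(** The tail bound, cut at the scale x = |m|^(-1/2). *)
Lemma gker_le_sqrt : exists C, 0 < C /\ forall m n, 1 <= `|m| ->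
  `|gker m n| <= C / Num.sqrt `|m|.
Proof.
have [C [C0 HC]] := integrand_tail.
exists (2 * (C + 10)); split; first by lra.
move=> m n m1; have nm : 0 < `|m| by lra.
pose s := Num.sqrt `|m|.
have s1 : 1 <= s by rewrite -sqrtr1 ler_wsqrtr.
have s0 : 0 < s by lra.
have s2 : s * s = `|m| by rewrite -expr2 sqr_sqrtr.
have sX : s^-1 <= xmax R.
  by apply: le_trans (xmax_ge1 R); rewrite invf_le1.
have i0 : 0 < s^-1 by rewrite invr_gt0.
have cX : cts 0 (xmax R) (integrand m n) by apply: integrand_cts => //; exact: xmax_lt2.
have h1 : `|Int 0 s^-1 (integrand m n)| <= 10 / s.
  apply: (@le_trans _ _ (Int 0 s^-1 (fun=> 10))).
    apply: norm_Int_le; [exact: cts_sub cX _ _|exact: cts_cst|].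
    move=> x /andP[x0 xX]; apply: integrand_le10 => //.
    by apply/ltW; apply: (@xmax_dom R); rewrite x0/= (le_trans xX).
  by rewrite Int_cst ?subr0// ltW.
have h2 : `|Int s^-1 (xmax R) (integrand m n)| <= C / s.
  apply: le_trans (HC m n _ _ i0 sX) _; first by rewrite -normr_gt0.
  by rewrite -s2 mulfK ?gt_eqF.
rewrite /gker (Int_split (ltW i0) sX cX) normrM (gtr0_norm inv4pi_gt0) -[leRHS]mulrA.
apply: ler_pM.
- exact/ltW/inv4pi_gt0.
- exact: normr_ge0.
- exact: inv4pi_le2.
- by apply: le_trans (ler_normD _ _) _; rewrite mulrDl addrC; exact: lerD.
Qed.

End KernelBounds.

(** * Limits of integrals with a controlled tail *)

Section TailLimit.
Variable R : realType.
Implicit Types (T e x y : R).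

(** A Cauchy criterion with a rate; the limit is the supremum of J T - C / T. *)
Lemma tail_limit (J : R -> R) C : 0 <= C ->
  (forall T T', 1 <= T -> T <= T' -> `|J T' - J T| <= C / T) ->
  exists L, forall T, 1 <= T -> `|J T - L| <= C / T.
Proof.
move=> C0 H; pose A := [set z | exists2 T, 1 <= T & z = J T - C / T].
have sep T T' : 1 <= T -> 1 <= T' -> J T' - C / T' <= J T + C / T.
  move=> T1 T1'.
  have c1 : 0 <= C / T by rewrite divr_ge0//; lra.
  have c2 : 0 <= C / T' by rewrite divr_ge0//; lra.
  have [TT'|T'T] := leP T T'.
    by have := H _ _ T1 TT'; rewrite ler_norml; move: (J T) (J T') (C / T) (C / T') c1 c2 => a b c d; lra.
  have := H _ _ T1' (ltW T'T); rewrite ler_norml.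
  by move: (J T) (J T') (C / T) (C / T') c1 c2 => a b c d; lra.
have ub : has_ubound A.
  by exists (J 1 + C / 1) => z [T' T1' ->]; exact: sep.
have Anz : A !=set0 by exists (J 1 - C / 1), 1.
exists (sup A) => T T1.
have lo : J T - C / T <= sup A by apply: ub_le_sup => //; exists T.
have hi : sup A <= J T + C / T by apply: ge_sup => // z [T' T1' ->]; exact: sep.
by rewrite ler_norml; move: lo hi; move: (sup A) (J T) (C / T) => a b c; lra.
Qed.

End TailLimit.

(** * The Fresnel integral is positive *)

Section Fresnel.
Variable R : realType.
Implicit Types (T e x y v : R).

Lemma is_derive_cos_sqr c x :
  is_derive x 1 (fun x : R => cos (c * x ^+ 2)) (- (2 * c * x * sin (c * x ^+ 2))).
Proof.
have h := is_derive_sqr c x.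
have k := @is_derive1_comp _ cos (fun x : R => c * x ^+ 2) x _ _
  (is_derive_cos (c * x ^+ 2)) h.
apply: (@is_derive_eq _ _ _ _ _ _ _ _ k).
ring.
Qed.

(** The boundary terms of two integrations by parts of cos (2 v^2), the second
with the primitive 1 - cos, which vanishes to second order at 0. *)
Definition fresnelH v : R :=
  sin (2 * v ^+ 2) * (4 * v)^-1 + (1 - cos (2 * v ^+ 2)) * (16 * v ^+ 3)^-1.

(** The derivative of [fresnelH]: it falls short of cos (2 v^2) by a
nonnegative function that is integrable at infinity. *)
Definition fresnelD v : R := cos (2 * v ^+ 2) - 3 / 16 * (1 - cos (2 * v ^+ 2)) * v ^- 4.

Lemma is_derive_fresnelH v : 0 < v -> is_derive v 1 fresnelH (fresnelD v).
Proof.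
move=> v0; have vn0 : v != 0 by rewrite gt_eqF.
have n1 : 4 * v != 0 by rewrite mulf_neq0.
have n2 : 16 * v ^+ 3 != 0 by rewrite mulf_neq0// expf_neq0.
have d4 : is_derive v 1 (fun x : R => 4 * x) 4.
  have := @is_deriveZ _ _ _ (@id R) 4 v 1 1 (is_derive_id v 1).
  by rewrite /GRing.scale/= mulr1.
have d16 : is_derive v 1 (fun x : R => 16 * x ^+ 3) (16 * (3 * v ^+ 2)).
  exact: (@is_deriveZ _ _ _ (fun x : R => x ^+ 3) 16 v 1 _ (is_derive_exp 2 v)).
have i4 := @is_deriveV R _ v _ 1 n1 d4.
have i16 := @is_deriveV R _ v _ 1 n2 d16.
have dc : is_derive v 1 (fun x : R => 1 - cos (2 * x ^+ 2)) (2 * 2 * v * sin (2 * v ^+ 2)).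
  have := @is_deriveB R R R (cst (1 : R)) (fun x : R => cos (2 * x ^+ 2)) v 1 _ _
     (@is_derive_cst R R R (1 : R) v 1) (is_derive_cos_sqr 2 v).
  by rewrite sub0r opprK.
have h1 := @is_deriveM R _ _ _ v 1 _ _ (is_derive_sin_sqr 2 v) i4.
have h2 := @is_deriveM R _ _ _ v 1 _ _ dc i16.
have h := @is_deriveD R _ _ _ _ v 1 _ _ h1 h2.
apply: (@is_derive_eq _ _ _ _ _ _ _ _ h).
rewrite /GRing.scale/= /fresnelD; field.
by [].
Qed.

Definition fresnel T : R := Int 0 T (fun v => cos (2 * v ^+ 2)).

Lemma cos_sqr_cts c a b : cts a b (fun v : R => cos (c * v ^+ 2)).
Proof. by move=> x _; exact: trig_cont (@continuous_cos R). Qed.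

Lemma norm_fresnelH_le v : 1 / 2 <= v -> `|fresnelH v| <= 3 / (4 * v).
Proof.
move=> v12; have v0 : 0 < v by lra.
have vn0 : v != 0 by rewrite gt_eqF.
have -> : fresnelH v = (sin (2 * v ^+ 2) * (4 * v ^+ 2) + (1 - cos (2 * v ^+ 2))) / (16 * v ^+ 3).
  by rewrite /fresnelH; field.
have -> : 3 / (4 * v) = (12 * v ^+ 2) / (16 * v ^+ 3) by field.
have p : 0 < 16 * v ^+ 3 by rewrite mulr_gt0// exprn_gt0.
rewrite normrM normfV (gtr0_norm p) ler_pM2r ?invr_gt0// ler_norml.
have := sin_le1 (2 * v ^+ 2); have := sin_geN1 (2 * v ^+ 2).
have := cos_le1 (2 * v ^+ 2); have := cos_geN1 (2 * v ^+ 2).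
move: (sin _) (cos _) => s c c1 c2 s1 s2.
have vv : 1 / 4 <= v ^+ 2 by nra.
move: (v ^+ 2) vv => q vv; apply/andP; split; nra.
Qed.

Lemma fresnel_increment T T' : 1 / 2 <= T -> T <= T' ->
  0 <= fresnel T' - fresnel T - (fresnelH T' - fresnelH T) <= 3 / 2 / T.
Proof.
move=> T12 TT'; have T0 : 0 < T by lra.
have cV : cts T T' (fun x => x ^- 4).
  move=> x /andP[ax _]; apply: continuousV; last exact: exprn_continuous.
  by rewrite expf_neq0// gt_eqF// (lt_le_trans T0).
have cG : cts T T' (fun v => 3 / 16 * (1 - cos (2 * v ^+ 2)) * v ^- 4).
  apply: ctsM => //; apply: ctsM; first exact: cts_cst.
  by apply: ctsB; [exact: cts_cst|exact: cos_sqr_cts].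
have cD : cts T T' fresnelD by apply: ctsB => //; exact: cos_sqr_cts.
have pw x : T <= x <= T' -> 0 <= 3 / 16 * (1 - cos (2 * x ^+ 2)) * x ^- 4 <= 3 / 2 * x ^- 2.
  move=> /andP[Tx _]; have x0 : 0 < x by lra.
  have -> : x ^- 4 = x ^- 2 * x ^- 2 by rewrite -invfM -exprD.
  have h1 : 0 < x ^- 2 by rewrite invr_gt0 exprn_gt0.
  have h2 : x ^- 2 <= 4.
    by rewrite -[4]invrK lef_pV2 ?posrE ?exprn_gt0 ?invr_gt0//; nra.
  have := cos_le1 (2 * x ^+ 2); have := cos_geN1 (2 * x ^+ 2).
  move: (cos _) (x ^- 2) h1 h2 => c q q0 q4 c1 c2.
  apply/andP; split; first by apply: mulr_ge0; apply: mulr_ge0; lra.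
  have : (1 - c) * q <= 8 by nra.
  nra.
have e1 : fresnelH T' - fresnelH T = Int T T' fresnelD.
  apply/esym/Int_FTC => // x /andP[Tx _]; apply: is_derive_fresnelH; lra.
have e2 : fresnel T' - fresnel T = Int T T' (fun v => cos (2 * v ^+ 2)).
  have T0' : 0 <= T by lra.
  rewrite /fresnel (Int_split T0' TT' (@cos_sqr_cts _ _ _)).
  by rewrite addrAC subrr add0r.
have -> : fresnel T' - fresnel T - (fresnelH T' - fresnelH T) =
  Int T T' (fun v => 3 / 16 * (1 - cos (2 * v ^+ 2)) * v ^- 4).
  rewrite e1 e2 -IntB//; last exact: cos_sqr_cts.
  by apply: eq_Int => x _; rewrite /fresnelD opprB addrC subrK.
apply/andP; split.
  rewrite -[leLHS](mul0r (T' - T)) -Int_cst//.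
  by apply: le_Int => //; [exact: cts_cst|move=> x /pw /andP[]].
have c32 : 0 <= 3 / 2 :> R by lra.
apply: le_trans (Int_inv_sqr T0 TT' c32).
apply: le_Int => //; last by move=> x /pw /andP[].
move=> x /andP[ax _]; apply: continuousM; first exact: cst_continuous.
apply: continuousV; last exact: exprn_continuous.
by rewrite expf_neq0// gt_eqF// (lt_le_trans T0).
Qed.

(** Taylor bounds at v = 1/2: the initial segment already beats the boundary
terms, 7/16 against 5/16. *)
Lemma fresnel_half : 1 / 8 <= fresnel (1 / 2) - fresnelH (1 / 2).
Proof.
have h1 : 7 / 16 <= fresnel (1 / 2).
  have -> : 7 / 16 = 7 / 8 * (1 / 2 - 0) :> R by field.
  rewrite -Int_cst; last by lra.
  apply: le_Int; [exact: cts_cst|exact: cos_sqr_cts|].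
  move=> x /andP[x0 x12]; have := cos_ge (2 * x ^+ 2).
  have : x ^+ 2 <= 1 / 4 by nra.
  by have := sqr_ge0 x; move: (x ^+ 2) (cos _) => q c; nra.
have h2 : fresnelH (1 / 2) <= 5 / 16.
  rewrite /fresnelH.
  have -> : 2 * (1 / 2) ^+ 2 = 1 / 2 :> R by field.
  have -> : 4 * (1 / 2) = 2 :> R by field.
  have -> : 16 * (1 / 2) ^+ 3 = 2 :> R by field.
  have := @sin_le R (1 / 2); have := cos_ge (1 / 2 : R).
  move: (sin _) (cos _) => s c; rewrite expr2; lra.
by lra.
Qed.

Lemma fresnel_limit :
  exists2 L, 0 < L & forall T, 1 <= T -> `|fresnel T - L| <= 3 / T.
Proof.
have cauchy T T' : 1 <= T -> T <= T' -> `|fresnel T' - fresnel T| <= 3 / T.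
  move=> T1 TT'; have T0 : 0 < T by lra.
  have := @fresnel_increment T T' => /(_ ltac:(lra) TT').
  have := @norm_fresnelH_le T => /(_ ltac:(lra)).
  have := @norm_fresnelH_le T' => /(_ ltac:(lra)).
  rewrite !ler_norml.
  have : 3 / (4 * T') <= 3 / (4 * T).
    by rewrite ler_pM2l// lef_pV2 ?posrE ?mulr_gt0//; lra.
  have -> : 3 / (4 * T) = 3 / 4 / T by rewrite invfM mulrA.
  have : 0 < T^-1 by rewrite invr_gt0.
  move: (T^-1) (3 / (4 * T')) (fresnel T) (fresnel T') (fresnelH T) (fresnelH T').
  by move=> a b c d e f; lra.
have [L HL] := tail_limit (ler0n R 3) cauchy.
exists L => //.
have := HL 100 => /(_ ltac:(lra)); rewrite ler_norml.
have := @fresnel_increment (1 / 2) 100 => /(_ ltac:(lra) ltac:(lra)).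
have := @norm_fresnelH_le 100 => /(_ ltac:(lra)); rewrite ler_norml.
have := fresnel_half.
move: (fresnel _) (fresnel _) (fresnelH _) (fresnelH _) => a b c d.
by lra.
Qed.

End Fresnel.

(** * Scaling limits of the Fourier integral *)

Section KernelLimits.
Variable R : realType.
Implicit Types (m l x T s e : R) (n : nat).

Lemma gker_rescale m n s T : 0 < s -> 0 <= T -> T <= s * xmax R ->
  s * gker m n = 4 / pi * (Int 0 T (fun v => integrand m n (v / s))
                          + s * Int (T / s) (xmax R) (integrand m n)).
Proof.
move=> s0 T0 TX.
have Ts0 : 0 <= T / s by rewrite divr_ge0// ltW.
have TsX : T / s <= xmax R by rewrite ler_pdivrMr// mulrC.
have cX : cts 0 (xmax R) (integrand m n) by apply: integrand_cts => //; exact: xmax_lt2.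
have e1 := Int_scale s0 Ts0 (cts_sub cX (lexx _) TsX).
rewrite mulrCA divff ?gt_eqF// mulr1 in e1.
by rewrite /gker (Int_split Ts0 TsX cX) mulrCA -e1 mulrDr.
Qed.

Lemma integrand_scale_cts m n s T : 0 < s -> T <= s * xmax R ->
  cts 0 T (fun v => integrand m n (v / s)).
Proof.
move=> s0 TX x /andP[x0 xT].
apply: (@continuous_comp _ _ _ (fun v : R => v / s) (integrand m n)).
  by apply: continuousM => //; exact: cst_continuous.
apply: integrand_cont; apply: xmax_dom; rewrite divr_ge0 ?(ltW s0)//=.
by rewrite ler_pdivrMr// (le_trans xT)// mulrC.
Qed.

Lemma weight_near1 x : 0 <= x -> x ^+ 2 <= 2 -> `|weight x - 1| <= 160 * x.
Proof. by move=> x0 x2; have := weight_lin x2; rewrite (ger0_norm x0). Qed.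

(** For n x small both r^n and [weight] are close to 1. *)
Lemma integrand_near_cos m n x : 0 <= x -> x ^+ 2 <= 2 ->
  `|integrand m n x - cos (2 * m * x ^+ 2)| <= 160 * (n%:R + 1) * x.
Proof.
move=> x0 x2; set c : R[i] := cis (- (2 * m * x ^+ 2)).
have -> : integrand m n x - cos (2 * m * x ^+ 2) =
   Re (c * croot x ^+ n) * (weight x - 1) + Re (c * (croot x ^+ n - 1)).
  have -> : cos (2 * m * x ^+ 2) = Re c by rewrite /= cosN.
  by rewrite /integrand -/c [c * (_ - _)]mulrBr mulr1 ReD ReN; ring.
apply: le_trans (ler_normD _ _) _; rewrite normrM.
have b1 : `|Re (c * croot x ^+ n)| <= 1.
  apply: le_trans (Re_le_normc _) _; rewrite normcM normc_cis mul1r normcX.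
  by rewrite exprn_ile1 ?normc_ge0 ?croot_le1.
have b2 : `|Re (c * (croot x ^+ n - 1))| <= n%:R * (2 * x).
  apply: le_trans (Re_le_normc _) _; rewrite normcM normc_cis mul1r.
  rewrite -[X in _ - X](expr1n _ n).
  apply: le_trans (@normcBX _ _ _ 1 _ (croot_le1 x) _) _; first by rewrite normc1.
  by rewrite expr1n mulr1 ler_wpM2l// distcC one_sub_croot_le.
have b3 := weight_near1 x0 x2.
have := normr_ge0 (weight x - 1); have := normr_ge0 (Re (c * croot x ^+ n)).
have nx : 0 <= n%:R * x by rewrite mulr_ge0.
move: (n%:R : R) nx b2 => N nx b2.
move: (`|weight x - 1|) (`|Re (c * croot x ^+ n)|) (`|Re _|) b1 b2 b3 => p q r b1 b2 b3 q0 p0.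
nra.
Qed.

(** Here r^n is compared with e^(-(1 - i) n x): the error O(x^2) of one factor
is multiplied by n. *)
Lemma integrand_near_exp m n x : 0 <= x -> x ^+ 2 <= 2 ->
  `|integrand m n x - expR (- (n%:R * x)) * cos (n%:R * x - 2 * m * x ^+ 2)|
    <= 160 * x + 20 * n%:R * x ^+ 2.
Proof.
move=> x0 x2; set c : R[i] := cis (- (2 * m * x ^+ 2)).
have -> : integrand m n x - expR (- (n%:R * x)) * cos (n%:R * x - 2 * m * x ^+ 2) =
   Re (c * croot x ^+ n) * (weight x - 1) + Re (c * (croot x ^+ n - cexp x ^+ n)).
  have -> : expR (- (n%:R * x)) * cos (n%:R * x - 2 * m * x ^+ 2) = Re (c * cexp x ^+ n).
    have -> : c * cexp x ^+ n = (expR (- (n%:R * x)))%:C%C * cis (n%:R * x - 2 * m * x ^+ 2).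
      by rewrite cexpX /cexp /c cisD; ring.
    by rewrite ReM /= mul0r subr0.
  by rewrite /integrand -/c [c * (_ - _)]mulrBr ReD ReN; ring.
apply: le_trans (ler_normD _ _) _; rewrite normrM.
have b1 : `|Re (c * croot x ^+ n)| <= 1.
  apply: le_trans (Re_le_normc _) _; rewrite normcM normc_cis mul1r normcX.
  by rewrite exprn_ile1 ?normc_ge0 ?croot_le1.
have b2 : `|Re (c * (croot x ^+ n - cexp x ^+ n))| <= n%:R * (20 * x ^+ 2).
  apply: le_trans (Re_le_normc _) _; rewrite normcM normc_cis mul1r.
  apply: le_trans (@normcBX _ _ _ 1 _ (croot_le1 x) _) _.
    by rewrite normc_cexp -expR0 ler_expR oppr_le0.
  by rewrite expr1n mulr1 ler_wpM2l// croot_cexp.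
have b3 := weight_near1 x0 x2.
have := normr_ge0 (weight x - 1); have := normr_ge0 (Re (c * croot x ^+ n)).
move: (n%:R : R) b2 => N b2.
move: (`|weight x - 1|) (`|Re (c * croot x ^+ n)|) (`|Re _|) b1 b2 b3 => p q r b1 b2 b3 q0 p0.
nra.
Qed.

Lemma cos_norm_mul m x : cos (2 * m * x ^+ 2) = cos (2 * (Num.sqrt `|m| * x) ^+ 2).
Proof.
rewrite exprMn sqr_sqrtr//; case: (ger0P m) => m0; first by congr cos; ring.
by rewrite -cosN; congr cos; ring.
Qed.

(** The scale is s = sqrt |m|.  On [0, T/s] the integrand is uniformly
close to the Fresnel integrand; beyond, [integrand_tail] applies. *)
Lemma gker_far_bound : exists C L : R, [/\ 0 < C, 0 < L & forall m n T,
  1 <= T -> T <= Num.sqrt `|m| ->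
  `|Num.sqrt `|m| * gker m n - L| <=
     C / T + 320 * (n%:R + 1) * T ^+ 2 / Num.sqrt `|m|].
Proof.
have [C [C0 HC]] := integrand_tail R.
have [L L0 HL] := fresnel_limit R.
exists (2 * (C + 3)), (4 / pi * L); split; first by lra.
  by rewrite mulr_gt0// inv4pi_gt0.
move=> m n T T1; set s := Num.sqrt `|m| => Ts.
have s0 : 0 < s by lra.
have s2 : s * s = `|m| by rewrite -expr2 sqr_sqrtr.
have TX : T <= s * xmax R by have := xmax_ge1 R; nra.
have T0 : 0 <= T by lra.
rewrite (gker_rescale m n s0 T0 TX) -mulrBr normrM (gtr0_norm (inv4pi_gt0 R)).
have b1 : `|Int 0 T (fun v => integrand m n (v / s)) - fresnel T| <= 160 * (n%:R + 1) * T ^+ 2 / s.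
  rewrite /fresnel -IntB; [|exact: integrand_scale_cts|exact: cos_sqr_cts].
  apply: (@le_trans _ _ (Int 0 T (fun=> 160 * (n%:R + 1) * (T / s)))); last first.
    by rewrite Int_cst// subr0 le_eqVlt; apply/orP; left; apply/eqP; ring.
  apply: norm_Int_le; [|exact: cts_cst|].
    by apply: ctsB; [exact: integrand_scale_cts|exact: cos_sqr_cts].
  move=> v /andP[v0 vT].
  have -> : cos (2 * v ^+ 2) = cos (2 * m * (v / s) ^+ 2).
    by rewrite [RHS]cos_norm_mul -/s; congr (cos (2 * _ ^+ 2)); field; rewrite gt_eqF.
  have x0 : 0 <= v / s by rewrite divr_ge0// ltW.
  have xX : v / s <= xmax R by rewrite ler_pdivrMr// (le_trans vT)// mulrC.
  have x2 : (v / s) ^+ 2 <= 2 by apply/ltW; apply: (@xmax_dom R); rewrite x0.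
  apply: le_trans (integrand_near_cos m n x0 x2) _.
  apply: ler_wpM2l; last by rewrite ler_pM2r ?invr_gt0.
  by apply: mulr_ge0; [exact: ler0n|apply: addr_ge0; [exact: ler0n|exact: ler01]].
have b2 : `|s * Int (T / s) (xmax R) (integrand m n)| <= C / T.
  rewrite normrM (gtr0_norm s0).
  have Tsp : 0 < T / s by rewrite divr_gt0//; lra.
  have TsX : T / s <= xmax R by rewrite ler_pdivrMr// mulrC.
  have mn0 : m != 0 by rewrite -normr_gt0 -s2 mulr_gt0.
  apply: le_trans (ler_wpM2l (ltW s0) (HC m n _ mn0 Tsp TsX)) _.
  rewrite -s2 le_eqVlt; apply/orP; left; apply/eqP; field.
  by rewrite !gt_eqF//; lra.
have b3 := HL T T1.
have := inv4pi_le2 R; have := inv4pi_gt0 R; move: (4 / pi) => c c0 c2.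
have -> : 2 * (C + 3) / T + 320 * (n%:R + 1) * T ^+ 2 / s =
  2 * (160 * (n%:R + 1) * T ^+ 2 / s + C / T + 3 / T) by ring.
apply: ler_pM => //; [exact: ltW|].
move: b1 b2 b3; move: (Int _ _ _) (fresnel T) (s * _) (_ / s) (C / T) (3 / T).
move=> a b d f g h; rewrite !ler_norml; lra.
Qed.

Lemma gker_far : exists2 L : R, 0 < L & forall e : R, 0 < e -> exists d M : R, 0 < d /\
  forall m n, M <= `|m| -> n%:R <= d * Num.sqrt `|m| ->
  `|Num.sqrt `|m| * gker m n - L| <= e.
Proof.
have [C [L [C0 L0 H]]] := gker_far_bound.
exists L => // e e0.
pose T := 1 + 2 * C / e.
have Ce : 0 < C / e by rewrite divr_gt0.
have T1 : 1 <= T by rewrite /T -mulrA; lra.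
have CT : C / T <= e / 2.
  rewrite ler_pdivrMr; last by lra.
  rewrite /T mulrDr; have -> : e / 2 * (2 * C / e) = C by field; rewrite gt_eqF.
  by lra.
pose K := 320 * T ^+ 2.
have K0 : 0 < K by rewrite mulr_gt0 ?ltr0n// exprn_gt0//; lra.
exists (e / (4 * K)), (T ^+ 2 + (4 * K / e) ^+ 2); split.
  by rewrite divr_gt0// mulr_gt0.
move=> m n mM nd; set s := Num.sqrt `|m| in nd *.
have sT : T <= s.
  rewrite -(@ler_pXn2r _ 2%N) ?nnegrE ?sqrtr_ge0//; last by lra.
  by rewrite sqr_sqrtr//; apply: le_trans mM; rewrite lerDl sqr_ge0.
have sK : 4 * K / e <= s.
  rewrite -(@ler_pXn2r _ 2%N) ?nnegrE ?sqrtr_ge0//; last first.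
    by apply: divr_ge0; [apply: mulr_ge0|]; rewrite ?ltW.
  by rewrite sqr_sqrtr//; apply: le_trans mM; rewrite lerDr sqr_ge0.
have s0 : 0 < s by lra.
apply: le_trans (H m n T T1 sT) _; rewrite -/s.
have -> : 320 * (n%:R + 1) * T ^+ 2 / s = K * n%:R / s + K / s by rewrite /K; ring.
have h1 : K * n%:R / s <= e / 4.
  rewrite ler_pdivrMr//; apply: le_trans (ler_wpM2l (ltW K0) nd) _.
  by rewrite le_eqVlt; apply/orP; left; apply/eqP; field; rewrite gt_eqF.
have h2 : K / s <= e / 4.
  rewrite ler_pdivrMr//; move: sK; rewrite ler_pdivrMr//; lra.
lra.
Qed.

Lemma expRN_le x : 0 < x -> expR (- x) <= 4 * x ^- 2.
Proof.
move=> x0.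
have h : x ^+ 2 / 4 <= expR x.
  have -> : expR x = expR (x / 2) ^+ 2 by rewrite -expRM_natl; congr expR; field.
  have -> : x ^+ 2 / 4 = (x / 2) ^+ 2 by field.
  by apply: sqr_le; [lra|have := expR_ge1Dx (x / 2); lra].
rewrite expRN -[4 * _]invrK lef_pV2 ?posrE ?expR_gt0//; last first.
  by rewrite invr_gt0 mulr_gt0// invr_gt0 exprn_gt0.
by rewrite invfM invrK mulrC.
Qed.

(** The scaling limit of the integrand along m = l n^2, with x = v / n. *)
Definition parabolic l v : R := expR (- v) * cos (v - 2 * l * v ^+ 2).

Lemma parabolic_cts l a b : cts a b (parabolic l).
Proof.
move=> x _; apply: continuousM.
  apply: (@continuous_comp _ _ _ (fun v : R => - v) (@expR R)); last exact: continuous_expR.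
  exact: opp_continuous.
apply: (@continuous_comp _ _ _ (fun v : R => v - 2 * l * v ^+ 2) (@cos R)); last exact: continuous_cos.
apply: continuousB => //.
by apply: continuousM; [exact: cst_continuous|exact: exprn_continuous].
Qed.

Lemma parabolic_limit l :
  exists L, forall T, 1 <= T -> `|Int 0 T (parabolic l) - L| <= 4 / T.
Proof.
apply: tail_limit => // T T' T1 TT'; have T0 : 0 < T by lra.
rewrite (Int_split (ltW T0) TT' (@parabolic_cts _ _ _)) addrAC subrr add0r.
apply: le_trans (Int_inv_sqr T0 TT' (ler0n R 4)).
apply: norm_Int_le; first exact: parabolic_cts.
  move=> x /andP[ax _]; apply: continuousM; first exact: cst_continuous.
  apply: continuousV; last exact: exprn_continuous.
  by rewrite expf_neq0// gt_eqF// (lt_le_trans T0).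
move=> x /andP[Tx _]; rewrite /parabolic normrM ger0_norm ?expR_ge0//.
apply: le_trans (expRN_le _); last by lra.
by rewrite ler_piMr ?expR_ge0// cos_max.
Qed.

Lemma parabolic_lip l l' v : 0 <= v ->
  `|parabolic l v - parabolic l' v| <= 2 * `|l - l'| * v ^+ 2.
Proof.
move=> v0; rewrite /parabolic -mulrBr normrM ger0_norm ?expR_ge0//.
have e1 : expR (- v) <= 1 by rewrite -expR0 ler_expR oppr_le0.
have h : `|cos (v - 2 * l * v ^+ 2) - cos (v - 2 * l' * v ^+ 2)| <= 2 * `|l - l'| * v ^+ 2.
  apply: (@le_trans _ _ (normc (cis (v - 2 * l * v ^+ 2) - cis (v - 2 * l' * v ^+ 2)))).
    have := Re_le_normc (cis (v - 2 * l * v ^+ 2) - cis (v - 2 * l' * v ^+ 2)).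
    by rewrite ReD ReN.
  apply: le_trans (normc_cisB _ _) _.
  rewrite (_ : _ - _ = 2 * (l' - l) * v ^+ 2); last by ring.
  by rewrite normrM (ger0_norm (sqr_ge0 v)) normrM distrC ger0_norm.
apply: le_trans h; rewrite ler_piMl//.
Qed.

(** The scale is n.  On [0, T/n] the integrand is uniformly close to
[parabolic]; beyond, the geometric decay of |r|^n suffices. *)
Lemma gker_near_bound l : exists L : R, forall m n T,
  1 <= T -> T <= n%:R ->
  `|n%:R * gker m n - L| <=
     2 * ((10 * 100 + 4) / T + (160 + 20 * T) * T ^+ 2 / n%:R + 2 * `|m / n%:R ^+ 2 - l| * T ^+ 3).
Proof.
have [L HL] := parabolic_limit l.
exists (4 / pi * L) => m n T T1 Tn.
have s0 : 0 < n%:R :> R by lra.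
have TX : T <= n%:R * xmax R by have := xmax_ge1 R; nra.
have T0 : 0 <= T by lra.
have b2 : `|n%:R * Int (T / n%:R) (xmax R) (integrand m n)| <= 10 * 100 / T.
  rewrite normrM (gtr0_norm s0).
  have Tsp : 0 <= T / n%:R by rewrite divr_ge0// ltW.
  have TsX : T / n%:R <= xmax R by rewrite ler_pdivrMr// mulrC.
  apply: le_trans (ler_wpM2l (ltW s0) (integrand_tail_pow m n Tsp TsX)) _.
  have y01 : 0 <= T / n%:R / 10 <= 1.
    by have := xmax_lt R; move: (T / n%:R) Tsp TsX => q; lra.
  have := pow_decay n.+1 y01.
  have := exprn_ge0 n.+1 (_ : 0 <= 1 - T / n%:R / 10); move=> /(_ ltac:(lra)).
  move: (_ ^+ n.+1) => q q0.
  have n1 : n%:R <= n.+1%:R :> R by rewrite ler_nat.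
  have n2 : n%:R <= n.+2%:R :> R by rewrite ler_nat ltnW.
  move: (n%:R : R) (n.+1%:R : R) (n.+2%:R : R) s0 n1 n2 => N N1 N2 s0 n1 n2.
  have -> : N2 * q * (T / N / 10) = N2 * q * T / (N * 10) by field; rewrite gt_eqF.
  rewrite ler_pdivrMr ?mulr_gt0// mul1r => H.
  have T0' : 0 < T by lra.
  have N10 : 0 < N1 by lra.
  rewrite ler_pdivlMr//.
  have -> : N * (100 / N1 * q) * T = (100 * (N * (q * T))) / N1 by field; rewrite gt_eqF.
  rewrite ler_pdivrMr//.
  have qT : 0 <= q * T by rewrite mulr_ge0.
  have H' : N * (q * T) <= N * 10 by apply: le_trans H; rewrite -mulrA; nra.
  by lra.
rewrite (gker_rescale m n s0 T0 TX) -mulrBr normrM (gtr0_norm (inv4pi_gt0 R)).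
have b1 : `|Int 0 T (fun v => integrand m n (v / n%:R)) - Int 0 T (parabolic l)| <=
    (160 + 20 * T) * T ^+ 2 / n%:R + 2 * `|m / n%:R ^+ 2 - l| * T ^+ 3.
  rewrite -IntB; [|exact: integrand_scale_cts|exact: parabolic_cts].
  pose B := (160 + 20 * T) * T / n%:R + 2 * `|m / n%:R ^+ 2 - l| * T ^+ 2.
  apply: (@le_trans _ _ (Int 0 T (fun=> B))); last first.
    by rewrite Int_cst// subr0 le_eqVlt; apply/orP; left; apply/eqP; rewrite /B; ring.
  apply: norm_Int_le; [|exact: cts_cst|].
    by apply: ctsB; [exact: integrand_scale_cts|exact: parabolic_cts].
  move=> v /andP[v0 vT].
  have x0 : 0 <= v / n%:R by rewrite divr_ge0// ltW.
  have xX : v / n%:R <= xmax R by rewrite ler_pdivrMr// (le_trans vT)// mulrC.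
  have x2 : (v / n%:R) ^+ 2 <= 2 by apply/ltW; apply: (@xmax_dom R); rewrite x0.
  have h1 := integrand_near_exp m n x0 x2.
  have h2 := parabolic_lip (m / n%:R ^+ 2) l v0.
  have e1 : n%:R * (v / n%:R) = v by rewrite mulrC divfK// gt_eqF.
  have e2 : 2 * m * (v / n%:R) ^+ 2 = 2 * (m / n%:R ^+ 2) * v ^+ 2.
    by field; rewrite gt_eqF.
  rewrite e1 e2 -/(parabolic _ _) in h1.
  have -> : integrand m n (v / n%:R) - parabolic l v = (integrand m n (v / n%:R) - parabolic (m / n%:R ^+ 2) v)
    + (parabolic (m / n%:R ^+ 2) v - parabolic l v) by ring.
  apply: le_trans (ler_normD _ _) _; apply: lerD.
    have e3 : 20 * n%:R * (v / n%:R) ^+ 2 = 20 * v * (v / n%:R).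
      by field; rewrite gt_eqF.
    apply: le_trans h1 _; rewrite e3 -mulrDl -[leRHS]mulrA; apply: ler_pM.
    - by apply: addr_ge0; [exact: ler0n|apply: mulr_ge0 => //; exact: ler0n].
    - exact: x0.
    - by rewrite lerD2l; apply: ler_wpM2l => //; exact: ler0n.
    - by rewrite ler_pM2r ?invr_gt0.
  apply: le_trans h2 _; apply: ler_wpM2l; first by rewrite mulr_ge0.
  exact: sqr_le.
have b3 := HL T T1.
have := inv4pi_le2 R; have := inv4pi_gt0 R; move: (4 / pi) => c c0 c2.
apply: ler_pM => //; [exact: ltW|].
have -> : (10 * 100 + 4) / T = 10 * 100 / T + 4 / T by rewrite -mulrDl.
move: b1 b2 b3; move: (Int _ _ _) (Int _ _ _) (n%:R * _) (_ / _) (_ * T ^+ 3)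
  (10 * 100 / T) (4 / T).
move=> a b d f g h i; rewrite !ler_norml; lra.
Qed.

Lemma gker_near l : exists L : R, forall e : R, 0 < e -> exists d N : R, 0 < d /\
  forall m n, N <= n%:R -> `|m / n%:R ^+ 2 - l| <= d ->
  `|n%:R * gker m n - L| <= e.
Proof.
have [L H] := gker_near_bound l.
exists L => e e0; pose C : R := 10 * 100 + 4.
have C0 : 0 < C by rewrite /C; lra.
pose T := 1 + 6 * C / e.
have Ce : 0 < C / e by rewrite divr_gt0.
have T1 : 1 <= T by rewrite /T -mulrA; lra.
have CT : C / T <= e / 6.
  rewrite ler_pdivrMr; last by lra.
  rewrite /T mulrDr; have -> : e / 6 * (6 * C / e) = C by field; rewrite gt_eqF.
  by lra.
pose K := (160 + 20 * T) * T ^+ 2.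
have K0 : 0 < K by rewrite mulr_gt0// ?exprn_gt0//; lra.
pose D := 2 * T ^+ 3.
have D0 : 0 < D by rewrite mulr_gt0// exprn_gt0//; lra.
exists (e / (6 * D)), (T + 6 * K / e); split.
  by rewrite divr_gt0// mulr_gt0.
have Ke : 0 < 6 * K / e by rewrite divr_gt0// mulr_gt0.
move=> m n nN md.
have nT : T <= n%:R by lra.
have n0 : 0 < n%:R :> R by lra.
apply: le_trans (H m n T T1 nT) _.
have h1 : K / n%:R <= e / 6.
  have : 6 * K / e <= n%:R by lra.
  rewrite !ler_pdivrMr//; lra.
have h2 : 2 * `|m / n%:R ^+ 2 - l| * T ^+ 3 <= e / 6.
  rewrite mulrAC -/D; apply: le_trans (ler_wpM2l (ltW D0) md) _.
  by rewrite le_eqVlt; apply/orP; left; apply/eqP; field; rewrite gt_eqF.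
rewrite -/K -/C; move: h1 h2 CT; move: (C / T) (K / _) (_ * T ^+ 3) => p q r; lra.
Qed.

End KernelLimits.

(** * A minimum principle on the lattice *)

Section MinPrinciple.
Variable R : realType.
Implicit Types (v : int * int -> R) (y : int * int).

Definition vanishing v := forall e : R, 0 < e -> exists N : nat,
  forall y, (N < `|y.1|)%N || (N < `|y.2|)%N -> `|v y| <= e.

Lemma vanishing_argmin v y0 : vanishing v -> v y0 < 0 ->
  exists2 y, v y < 0 & forall x, v y <= v x.
Proof.
move=> vv vy0.
have e0 : 0 < - v y0 / 2 by rewrite divr_gt0// oppr_gt0.
have [N HN] := vv _ e0.
pose pt (p : 'I_(N.*2.+1) * 'I_(N.*2.+1)) : int * int := (p.1%:Z - N%:Z, p.2%:Z - N%:Z).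
have box y : v y <= v y0 -> exists p, pt p = y.
  move=> vy.
  have : ~~ ((N < `|y.1|)%N || (N < `|y.2|)%N).
    apply/negP => /HN; rewrite ler0_norm; last by lra.
    by lra.
  rewrite negb_or -!leqNgt => /andP[h1 h2].
  have l1 : (absz (y.1 + N%:Z)%R < N.*2.+1)%N by lia.
  have l2 : (absz (y.2 + N%:Z)%R < N.*2.+1)%N by lia.
  exists (Ordinal l1, Ordinal l2); rewrite /pt /=.
  by case: y h1 h2 {vy l1 l2} => a b /= h1 h2; congr (_, _); lia.
have [p0 p0E] := box y0 (lexx _).
case: (@arg_minP _ _ _ p0 xpredT (fun p => v (pt p)) isT) => p _ pmin.
exists (pt p); first by rewrite (le_lt_trans (pmin p0 isT))// p0E.
move=> x; have [xy|/ltW xy] := leP (v x) (v y0).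
  by have [q <-] := box x xy; exact: pmin.
by rewrite (le_trans (pmin p0 isT))// p0E.
Qed.

(** A negative infimum is attained, since the function tends to 0; if it
propagates upwards from every vertex where it is attained, the function is
constant and negative along a vertical ray, which is impossible. *)
Lemma min_principle v : vanishing v ->
  (forall y, v y < 0 -> (forall x, v y <= v x) -> v (y.1, y.2 + 1) <= v y) ->
  forall y, 0 <= v y.
Proof.
move=> vv up y0; rewrite leNgt; apply/negP => vy0.
have [y vy ymin] := vanishing_argmin vv vy0.
have ray (k : nat) : v (y.1, y.2 + k%:Z) = v y.
  elim: k => [|k IH]; first by rewrite addr0; case: (y).
  apply/eqP; rewrite eq_le ymin andbT.
  have -> : (y.1, y.2 + k.+1%:Z) = ((y.1, y.2 + k%:Z).1, (y.1, y.2 + k%:Z).2 + 1).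
    by congr (_, _) => /=; rewrite -addn1 PoszD addrA.
  by apply: le_trans (up _ _ _) _; rewrite IH.
have e0 : 0 < - v y / 2 by rewrite divr_gt0// oppr_gt0.
have [N HN] := vv _ e0.
have := HN (y.1, y.2 + (N + absz y.2)%N.+1%:Z); rewrite ray => H.
have : (N < absz (y.2 + (N + absz y.2)%N.+1%:Z)%R)%N by lia.
move=> h; have := H _; rewrite /= h orbT => /(_ isT).
by rewrite ler0_norm; [lra|exact: ltW].
Qed.

End MinPrinciple.

(** * The Green function as the vanishing solution of an averaging equation *)

Section Walk.
Variable R : realType.
Implicit Types (v : int * int -> R) (x y z : int * int) (n : nat).

Definition in_nbrs y : seq (int * int) :=
  if y.2 == 0 then [:: (y.1, y.2 + 1); (y.1, y.2 - 1)]
  else [:: (y.1, y.2 + 1); (y.1, y.2 - 1); (y.1 - sgz y.2, y.2)].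

Definition deg y : R := if y.2 == 0 then 2 else 3.

(** Each vertex has as many in-neighbours as out-neighbours, so the measure
giving mass deg to each vertex is invariant for the walk, and
the average over in-neighbours is the transition operator of the
time-reversed walk: divided by [deg], the law of the walk evolves by [avg]. *)
Definition avg v y : R := (\sum_(x <- in_nbrs y) v x) / deg y.

Lemma deg_gt0 y : 0 < deg y.
Proof. by rewrite /deg; case: ifP. Qed.

Lemma in_nbrsE x y : (x \in in_nbrs y) = edge x y.
Proof.
case: x y => [a b] [c d]; rewrite /in_nbrs /edge /=.
case: (d =P 0) => [->|/eqP d0]; rewrite !inE !xpair_eqE /=; last first.
  apply/idP/idP.
    move=> /or3P[] /andP[/eqP -> /eqP ->]; rewrite ?eqxx /=.
    - by rewrite addrK eqxx orbT.
    - by rewrite subrK eqxx.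
    - by rewrite sgz_eq0 d0 subrK eqxx orbT.
  move=> /orP[/andP[/eqP -> /orP[/eqP ->|/eqP ->]]|/and3P[sb /eqP -> /eqP ->]].
  - by rewrite addrK !eqxx orbT.
  - by rewrite subrK !eqxx.
  - by rewrite addrK !eqxx !orbT.
apply/idP/idP.
  by move=> /orP[] /andP[/eqP -> /eqP ->]; rewrite ?eqxx.
move=> /orP[/andP[/eqP -> /orP[/eqP h|/eqP h]]|/and3P[sb /eqP h]].
- by rewrite eqxx /= (_ : b = -1) ?eqxx ?orbT//; lia.
- by rewrite eqxx /= (_ : b = 1) ?eqxx//; lia.
- by rewrite -h sgz0 eqxx in sb.
Qed.

Lemma uniq_in_nbrs y : uniq (in_nbrs y).
Proof.
case: y => c d; rewrite /in_nbrs /=; case: (d =P 0) => d0 /=; rewrite !inE !xpair_eqE !eqxx /=.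
  by rewrite d0.
by have s0 : sgz d != 0 by [rewrite sgz_eq0; apply/eqP]; lia.
Qed.

Lemma step_probE x y : step_prob R x y = if x \in in_nbrs y then (deg x)^-1 else 0.
Proof.
by rewrite in_nbrsE /step_prob /deg; case: ifP => // _; case: ifP.
Qed.

Lemma traj_prob_rcons x t y : traj_prob R x (rcons t y) = traj_prob R x t * step_prob R (last x t) y.
Proof.
elim: t x => [|u t IH] x /=; first by rewrite mulr1 mul1r.
by rewrite IH mulrA.
Qed.

Lemma traj_prob_ge0 x t : 0 <= traj_prob R x t.
Proof.
elim: t x => [//|u t IH] x /=; rewrite mulr_ge0// /step_prob.
by case: ifP => // _; case: ifP; rewrite invr_ge0.
Qed.

(** The law of the walk at time n divided by the invariant measure [deg]. *)
Fixpoint walk_density z n y : R :=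
  if n is n'.+1 then avg (walk_density z n') y else (y == z)%:R / deg y.

(** Induction on the last step of the trajectory.  The free factor c absorbs
the probability of that step, so the induction never takes a constant out of
an infinite sum. *)
Lemma walk_prob_scaled z n c y : 0 <= c ->
  \esum_(t in [set t : n.-tuple (int * int) | last z t = y]) (c * traj_prob R z t)%:E
  = (c * (deg y * walk_density z n y))%:E.
Proof.
elim: n c y => [|n IH] c y c0.
  rewrite /= [deg y * _]mulrC divfK ?gt_eqF ?deg_gt0//.
  have [->|yz] := eqVneq y z.
    rewrite (_ : [set t : 0.-tuple _ | _] = [set [tuple]]); last first.
      by apply/seteqP; split => t //= _; rewrite (tuple0 t).
    by rewrite esum_set1//= mulr1 lee_fin.
  rewrite (_ : [set t : 0.-tuple _ | _] = set0) ?esum_set0 ?mulr0//.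
  apply/seteqP; split => t //=; rewrite (tuple0 t)/= => zy.
  by rewrite zy eqxx in yz.
have bij : set_bij [set: n.-tuple (int * int)]
   [set t : n.+1.-tuple (int * int) | last z t = y] (fun t => [tuple of rcons t y]).
  split.
  - by move=> t _ /=; rewrite last_rcons.
  - move=> t t' _ _ /(congr1 val) /= /rcons_inj[tt'].
    exact: val_inj.
  - move=> t /= tz; case/tupleP: t tz => u t /= tz.
    have sz : size (belast u t) == n by rewrite size_belast size_tuple.
    exists (Tuple sz) => //; apply: val_inj => /=.
    by rewrite -tz -lastI.
rewrite (reindex_esum _ _ _ _ bij).
transitivity (\esum_(t in [set: n.-tuple (int * int)])
   \sum_(x <- in_nbrs y) (if t \in [set t : n.-tuple (int * int) | last z t = x]
      then (c / deg x * traj_prob R z t)%:E else 0)%E).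
  apply: eq_esum => t _ /=; rewrite traj_prob_rcons step_probE.
  case: ifPn => ly.
    rewrite (bigD1_seq (last z t)) ?uniq_in_nbrs//= mem_set//.
    rewrite big1 ?adde0; last first.
      move=> x xl; rewrite memNset//= => lx; by rewrite lx eqxx in xl.
    by congr _%:E; rewrite mulrA mulrAC.
  rewrite big_seq big1 ?mulr0// => x xy; rewrite memNset//= => lx.
  by rewrite lx xy in ly.
rewrite esum_sum; last first.
  move=> t x _ _; case: ifP => // _; rewrite lee_fin mulr_ge0 ?traj_prob_ge0//.
  by rewrite divr_ge0// ltW ?deg_gt0.
have cd0 x : 0 <= c / deg x by rewrite divr_ge0// ltW ?deg_gt0.
under eq_bigr => x _ do rewrite -esum_mkcond IH//.
rewrite sumEFin; congr _%:E => /=.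
rewrite /avg [deg y * _]mulrC divfK ?gt_eqF ?deg_gt0// mulr_sumr.
by apply: eq_bigr => x _; rewrite mulrA divfK// gt_eqF ?deg_gt0.
Qed.

Lemma walk_probE z n y : walk_prob R n z y = (deg y * walk_density z n y)%:E.
Proof.
have := @walk_prob_scaled z n 1 y ler01; rewrite mul1r => <-.
by apply: eq_esum => t _; rewrite mul1r.
Qed.

Lemma le_avg v v' y : (forall x, v x <= v' x) -> avg v y <= avg v' y.
Proof.
move=> vv'; rewrite /avg ler_pM2r ?invr_gt0 ?deg_gt0//.
by apply: ler_sum => x _.
Qed.

Lemma avgB v v' y : avg (fun x => v x - v' x) y = avg v y - avg v' y.
Proof. by rewrite /avg sumrB mulrBl. Qed.

Lemma superharmonic_ge0 v : vanishing v -> (forall y, avg v y <= v y) -> forall y, 0 <= v y.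
Proof.
move=> vv sup; apply: min_principle => // y _ ymin.
have := sup y; rewrite /avg ler_pdivrMr ?deg_gt0// /in_nbrs /deg.
case: eqP => _; rewrite !big_cons big_nil.
  have := ymin (y.1, y.2 - 1).
  by move: (v y) (v _) (v _) => a b c; lra.
have := ymin (y.1, y.2 - 1); have := ymin (y.1 - sgz y.2, y.2).
by move: (v y) (v _) (v _) (v _) => a b c d; lra.
Qed.

(** Uniqueness for the averaging equation.  U is nonnegative by the minimum
principle, so it dominates the partial sums of the Green series by induction;
then the limit V of these sums satisfies the same equation, and the minimum
principle applied to V - U, which is at most 0 and tends to 0, gives U <= V. *)
Lemma green_potential z U : vanishing U ->
  (forall y, U y = (y == z)%:R / deg y + avg U y) ->
  (forall y, 0 <= U y) /\ forall y, green R z y = (deg y * U y)%:E.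
Proof.
move=> vU UE.
have U0 : forall y, 0 <= U y.
  apply: superharmonic_ge0 => // y; rewrite [leRHS]UE lerDr.
  by rewrite divr_ge0// ltW ?deg_gt0.
have occ0 n y : 0 <= walk_density z n y.
  elim: n y => [|n IH] y /=; first by rewrite divr_ge0// ltW ?deg_gt0.
  by rewrite /avg divr_ge0 ?(ltW (deg_gt0 _))// sumr_ge0.
pose S n y := \sum_(0 <= k < n) walk_density z k y.
have SS n y : S n.+1 y = (y == z)%:R / deg y + avg (S n) y.
  rewrite /S big_nat_recl//; congr (_ + _).
  by rewrite /avg exchange_big/= mulr_suml.
have SU n y : S n y <= U y.
  elim: n y => [|n IH] y; first by rewrite /S big_geq.
  by rewrite SS UE lerD2l le_avg.
have Snd y : nondecreasing_seq (S ^~ y).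
  by apply/nondecreasing_seqP => n; rewrite /S big_nat_recr//= lerDl.
have cS y : S n y @[n --> \oo] --> sup (range (S ^~ y)).
  apply: nondecreasing_cvgn => //.
  by exists (U y) => _ [n _ <-].
pose V y := sup (range (S ^~ y)).
have VU y : V y <= U y.
  by apply: ge_sup; [exists (S 0%N y), 0%N|move=> _ [n _ <-]].
have V0 y : 0 <= V y.
  apply: le_trans (_ : S 0%N y <= _); first by rewrite /S big_geq.
  apply: ub_le_sup; last by exists 0%N.
  by exists (U y) => _ [n _ <-].
have VE y : V y = (y == z)%:R / deg y + avg V y.
  have c1 : S n.+1 y @[n --> \oo] --> V y by have := cS y; rewrite -cvg_shiftS.
  have c2 : (y == z)%:R / deg y + avg (S n) y @[n --> \oo] --> (y == z)%:R / deg y + avg V y.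
    apply: cvgD; first exact: cvg_cst.
    apply: cvgMl; rewrite /in_nbrs; case: ifP => _; rewrite !big_cons !big_nil.
      under eq_fun do rewrite !big_cons big_nil.
      by apply: cvgD; [exact: cS|apply: cvgD; [exact: cS|exact: cvg_cst]].
    under eq_fun do rewrite !big_cons big_nil.
    apply: cvgD; [exact: cS|apply: cvgD; [exact: cS|]].
    by apply: cvgD; [exact: cS|exact: cvg_cst].
  have Seq : (fun n => S n.+1 y) = (fun n => (y == z)%:R / deg y + avg (S n) y).
    by apply/funext => n; exact: SS.
  rewrite Seq in c1.
  exact: (cvg_unique _ c1 c2).
have W0 : forall y, 0 <= V y - U y.
  apply: superharmonic_ge0 => [e e0|y].
    have [N HN] := vU _ e0; exists N => y /HN.
    have := V0 y; have := VU y; rewrite !ler_norml.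
    by move: (V y) (U y) => a b; lra.
  by rewrite avgB [in leRHS]VE [in leRHS]UE opprD addrACA subrr add0r.
have VUE y : V y = U y.
  by apply/eqP; rewrite eq_le VU -subr_ge0 W0.
split => // y; rewrite /green.
apply/cvg_lim => //.
have -> : (fun n => (\sum_(0 <= k < n) walk_prob R k z y)%E) = (fun n => (deg y * S n y)%:E).
  apply/funext => n; rewrite /S mulr_sumr -sumEFin.
  by apply: eq_bigr => k _; exact: walk_probE.
apply: cvg_EFin; first by near=> n.
rewrite -VUE.
suff : deg y * S n y @[n --> \oo] --> deg y * V y by [].
by apply: cvgM; [exact: cvg_cst|exact: cS].
Unshelve. all: by end_near. Qed.

End Walk.

(** * The Fourier integral computes the Green function *)

Section Potential.
Variable R : realType.
Implicit Types (x y z : int * int) (n : nat) (k : int).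

(** The abscissa relative to the source, reflected below the axis: this is the
central symmetry of the lattice. *)
Definition signed_shift z y : int := (if 0 <= y.2 then 1 else -1) * (y.1 - z.1).

Definition potential z y : R := gker (signed_shift z y)%:~R `|y.2| / 2.

Lemma gker0N (m : R) : gker (- m) 0 = gker m 0.
Proof.
rewrite /gker; congr (_ * _); apply: eq_Int => x _.
rewrite !integrandE expr0 /= mulrN mulNr cosN; ring.
Qed.

Lemma potential_nonneg z (a : int) n : potential z (a, n%:Z) = gker (a - z.1)%:~R n / 2.
Proof. by rewrite /potential /signed_shift /= mul1r. Qed.

Lemma potential_nonpos z (a : int) n : potential z (a, - n%:Z) = gker (- (a - z.1)%:~R) n / 2.
Proof.
rewrite /potential /signed_shift /= abszN absz_nat.
case: n => [|n]; first by rewrite oppr0 lexx mul1r gker0N.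
have -> : (0 <= - n.+1%:Z) = false by lia.
by rewrite mulN1r rmorphN.
Qed.

Lemma avg_axis v (a : int) : avg v (a, 0) = (v (a, 1%:Z) + v (a, - 1%:Z)) / 2 :> R.
Proof. by rewrite /avg /in_nbrs /deg eqxx /= !big_cons big_nil addr0 add0r sub0r. Qed.

Lemma avg_above v (a : int) n : avg v (a, n.+1%:Z) =
  (v (a, n.+2%:Z) + v (a, n%:Z) + v (a - 1, n.+1%:Z)) / 3 :> R.
Proof.
rewrite /avg /in_nbrs /deg [(a, n.+1%:Z).2]/= [(a, n.+1%:Z).1]/=.
have -> : (n.+1%:Z == 0) = false by [].
rewrite !big_cons big_nil addr0 addrA.
have -> : n.+1%:Z + 1 = n.+2%:Z by rewrite -PoszD addn1.
have -> : n.+1%:Z - 1 = n%:Z by rewrite -addn1 PoszD addrK.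
by have -> : sgz n.+1%:Z = 1 by [].
Qed.

Lemma avg_below v (a : int) n : avg v (a, - n.+1%:Z) =
  (v (a, - n%:Z) + v (a, - n.+2%:Z) + v (a + 1, - n.+1%:Z)) / 3 :> R.
Proof.
rewrite /avg /in_nbrs /deg [(a, - n.+1%:Z).2]/= [(a, - n.+1%:Z).1]/=.
have -> : (- n.+1%:Z == 0) = false by rewrite oppr_eq0.
rewrite !big_cons big_nil addr0 addrA.
have -> : - n.+1%:Z + 1 = - n%:Z by rewrite -addn1 PoszD opprD subrK.
have -> : - n.+1%:Z - 1 = - n.+2%:Z by rewrite -opprD -PoszD addn1.
by have -> : sgz (- n.+1%:Z) = -1 by []; rewrite opprK.
Qed.

Lemma potentialE z y : z.2 = 0 ->
  potential z y = (y == z)%:R / deg R y + avg (potential z) y.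
Proof.
case: z y => [z1 z2] [a b] /= ->.
case: b => [[|k]|k].
- rewrite avg_axis (potential_nonneg _ _ 0) potential_nonneg potential_nonpos /=.
  rewrite gker_axis xpair_eqE eqxx andbT subr_eq0 /deg /=.
  by move: (gker _ 1) (gker _ 1) ((a == z1)%:R) => p q r; lra.
- rewrite avg_above !potential_nonneg /= xpair_eqE andbF mul0r add0r.
  have := gker_rec ((a - z1)%:~R : R) k.
  rewrite -[_ - 1](rmorphB _ (a - z1) 1) [a - z1 - 1]addrAC.
  by move: (gker _ _) (gker _ _) (gker _ _) (gker _ _) => p q r s; lra.
- rewrite NegzE avg_below !potential_nonpos /= xpair_eqE oppr_eq0 andbF mul0r add0r.
  have := gker_rec (- (a - z1)%:~R : R) k.
  have -> : - (a - z1)%:~R - 1 = - (a + 1 - z1)%:~R :> R.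
    by rewrite -opprD -(rmorphD _ (a - z1) 1) [a - z1 + 1]addrAC.
  by move: (gker _ _) (gker _ _) (gker _ _) (gker _ _) => p q r s; lra.
Qed.

Lemma inv_nat_small (C e : R) : 0 <= C -> 0 < e ->
  exists N : nat, forall n, (N <= n)%N -> C / n.+1%:R <= e.
Proof.
move=> C0 e0; exists (Num.bound (C / e)) => n Nn.
rewrite ler_pdivrMr ?ltr0n// mulrC -ler_pdivrMr//.
have := archi_boundP (divr_ge0 C0 (ltW e0)) => /ltW h.
by apply: le_trans h _; rewrite ler_nat leqW.
Qed.

Lemma gker_vanishing : forall e : R, 0 < e -> exists N : nat, forall k n,
  (N < `|k|)%N || (N < n)%N -> `|gker k%:~R n : R| <= e.
Proof.
move=> e e0; have [C [C0 HC]] := gker_le_sqrt R.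
have [N1 H1] := inv_nat_small (ler0n R 200) e0.
have [N2 H2] := inv_nat_small (sqr_ge0 (C / e)) ltr01.
exists (maxn N1 N2) => k n /orP[|] h.
  have k1 : 1 <= `|k%:~R : R|.
    by rewrite -intr_norm ler1z; lia.
  apply: le_trans (HC _ _ k1) _.
  rewrite ler_pdivrMr; last by rewrite sqrtr_gt0; lra.
  rewrite mulrC -ler_pdivrMr//.
  rewrite -(@ler_pXn2r _ 2%N) ?nnegrE ?sqrtr_ge0//; last by rewrite divr_ge0 ?ltW.
  rewrite sqr_sqrtr//.
  have := H2 (absz k).-1; rewrite prednK; last by lia.
  have h2 : (N2 <= (absz k).-1)%N by lia.
  move=> /(_ h2); rewrite ler_pdivrMr ?mul1r; last by rewrite ltr0n; lia.
  by move=> h3; apply: le_trans h3 _; rewrite -intr_norm natr_absz.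
apply: le_trans (gker_le_inv _ _) _; apply: H1; lia.
Qed.

Lemma potential_vanishing z : vanishing (potential z).
Proof.
move=> e e0; have e2 : 0 < 2 * e by rewrite mulr_gt0.
have [N HN] := gker_vanishing e2; exists (N + `|z.1|)%N => y yN.
rewrite /potential normrM [X in _ * X]ger0_norm ?invr_ge0// ler_pdivrMr// mulrC.
rewrite mulrC [e * 2]mulrC; apply: HN.
by rewrite /signed_shift; move: yN; case: ifP => _; lia.
Qed.

Lemma green_gker z y : z.2 = 0 -> green R z y = (deg R y * potential z y)%:E.
Proof.
by move=> z2; have [_] := green_potential (@potential_vanishing z) (fun y => potentialE y z2).
Qed.

Lemma gker_ge0 k n : 0 <= gker k%:~R n :> R.
Proof.
have [H _] := green_potential (@potential_vanishing (0, 0)) (fun y => @potentialE (0, 0) y erefl).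
have := H (k, n%:Z); rewrite /potential /signed_shift /= subr0 mul1r.
by rewrite pmulr_lge0// invr_gt0.
Qed.

(** If the value at k were 0, nonnegativity in the two recurrences would spread
the zero to all abscissas below k, contradicting the positive limit
[gker_far]. *)
Lemma gker_axis_gt0 k : 0 < gker k%:~R 0 :> R.
Proof.
have axis := gker_axis R; rewrite lt_def gker_ge0 andbT; apply/eqP => k0.
have := axis k; rewrite k0.
have := gker_ge0 k 1; have := gker_ge0 (- k) 1; rewrite rmorphN.
have [->|kn0] := eqVneq k 0; first by rewrite /=; lra.
move=> h1 h2 h3; have {h1 h2 h3}k1 : gker k%:~R 1 = 0 :> R by move: h3; rewrite /=; lra.
have line (j : nat) : gker (k - j%:Z)%:~R 1 = 0 :> R.
  elim: j => [|j IH]; first by rewrite subr0.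
  have := gker_rec ((k - j%:Z)%:~R : R) 0; rewrite IH mulr0.
  rewrite -[_ - 1](rmorphB _ (k - j%:Z) 1).
  have -> : k - j%:Z - 1 = k - j.+1%:Z by rewrite -addn1 PoszD opprD addrA.
  have := gker_ge0 (k - j%:Z) 0; have := gker_ge0 (k - j%:Z) 2.
  by have := gker_ge0 (k - j.+1%:Z) 1; lra.
have line0 (j : nat) : gker (k - j%:Z)%:~R 0 = 0 :> R.
  have := gker_rec ((k - j%:Z)%:~R : R) 0; rewrite line mulr0.
  rewrite -[_ - 1](rmorphB _ (k - j%:Z) 1).
  have -> : k - j%:Z - 1 = k - j.+1%:Z by rewrite -addn1 PoszD opprD addrA.
  have := gker_ge0 (k - j%:Z) 0; have := gker_ge0 (k - j%:Z) 2.
  by have := gker_ge0 (k - j.+1%:Z) 1; lra.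
have [L L0 HL] := gker_far R.
have [d [M [d0 HM]]] := HL (L / 2) ltac:(lra).
(* far enough to the left, the zero contradicts the limit *)
pose j := (Num.bound `|M| + absz k)%N.
have Mj : M <= `|(k - j%:Z)%:~R : R|.
  apply: le_trans (ler_norm _) _; apply: le_trans (ltW (archi_boundP (normr_ge0 M))) _.
  rewrite -intr_norm -[X in X <= _]/((Num.bound `|M|)%:~R) ler_int /j; lia.
have := HM _ 0%N Mj; rewrite line0 mulr0 sub0r normrN.
have -> : (0 <= d * Num.sqrt `|(k - j%:Z)%:~R|) = true by rewrite mulr_ge0 ?sqrtr_ge0// ltW.
by move=> /(_ isT); rewrite gtr0_norm//; lra.
Qed.

Lemma gker_axis_lower : exists2 c : R, 0 < c &
  forall k, c <= gker k%:~R 0 * Num.sqrt (1 + `|k%:~R|).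
Proof.
have [L L0 HL] := gker_far R.
have [d [M [d0 HM]]] := HL (L / 2) ltac:(lra).
have [c c0 Hc] : exists2 c : R, 0 < c & forall j : nat, (j < Num.bound `|M|)%N -> c <= gker j%:~R 0.
  elim: (Num.bound `|M|) => [|N [c c0 Hc]]; first by exists 1.
  exists (Num.min c (gker N%:~R 0)); first by rewrite lt_min c0 gker_axis_gt0.
  move=> j; rewrite ltnS leq_eqVlt => /orP[/eqP ->|jN].
    by rewrite ge_min lexx orbT.
  by rewrite ge_min Hc.
exists (Num.min c (L / 2)); first by rewrite lt_min c0 divr_gt0.
move=> k.
have sq1 : 1 <= Num.sqrt (1 + `|k%:~R : R|).
  by rewrite -[leLHS]sqrtr1 ler_wsqrtr// lerDl.
have [kN|Nk] := ltnP (absz k) (Num.bound `|M|).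
  rewrite ge_min; apply/orP; left.
  apply: (@le_trans _ _ (gker k%:~R 0)).
    case: k kN sq1 => k kN _; first exact: Hc.
    by rewrite NegzE rmorphN gker0N; exact: Hc.
  by rewrite ler_peMr// gker_ge0.
rewrite ge_min; apply/orP; right.
have Mk : M <= `|k%:~R : R|.
  apply: le_trans (ler_norm _) _; apply: le_trans (ltW (archi_boundP (normr_ge0 M))) _.
  rewrite -intr_norm -[X in X <= _]/((Num.bound `|M|)%:~R) ler_int; lia.
have := HM _ 0%N Mk.
have -> : (0 <= d * Num.sqrt `|k%:~R|) = true by rewrite mulr_ge0 ?sqrtr_ge0// ltW.
move=> /(_ isT); rewrite ler_norml => /andP[h _].
have : Num.sqrt `|k%:~R : R| * gker k%:~R 0 <= gker k%:~R 0 * Num.sqrt (1 + `|k%:~R|).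
  by rewrite mulrC ler_wpM2l ?gker_ge0// ler_wsqrtr// lerDr.
lra.
Qed.

Lemma pow_bernoulli (t : R) n : 0 <= t <= 1 -> (1 - t) ^+ n * (1 + n%:R * t) <= 1.
Proof.
move=> /andP[t0 t1]; elim: n => [|n IH]; first by rewrite expr0 mul0r addr0 mul1r.
apply: le_trans IH; rewrite exprS -natr1.
have p0 : 0 <= (1 - t) ^+ n by rewrite exprn_ge0// subr_ge0.
rewrite [(1 - t) * _]mulrC -mulrA ler_wpM2l//.
have : 0 <= n%:R * t :> R by rewrite mulr_ge0.
nra.
Qed.

Lemma geom_small (q e : R) : 0 <= q < 1 -> 0 < e ->
  exists N : nat, forall n, (N <= n)%N -> q ^+ n <= e.
Proof.
move=> /andP[q0 q1] e0; have y0 : 0 < 1 - q by lra.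
have iv : 0 <= (1 - q)^-1 by rewrite invr_ge0 ltW.
have [N HN] := inv_nat_small iv e0.
exists N => n /HN; apply: le_trans.
have q01 : 0 <= 1 - q <= 1 by lra.
have := pow_decay n q01.
rewrite (_ : 1 - (1 - q) = q); last by ring.
move=> h; rewrite ler_pdivlMr ?ltr0n// -[leRHS]mul1r ler_pdivlMr//.
by apply: le_trans h; rewrite [q ^+ n * _]mulrC.
Qed.

Section Subsolution.
Variables (M : int) (n0 : nat).
Hypothesis n0_gt0 : (0 < n0)%N.

(* Up to constants, p is the width and n0 the height of the comparison
   solution. *)
Let p : R := n0%:R * n0.+1%:R.
Let w : R := 1 - p^-1.
Let rho : R := n0%:R / n0.+1%:R.

Lemma subsol_p_ge1 : 1 <= p.
Proof. by rewrite /p -natrM ler1n muln_gt0 n0_gt0. Qed.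

Lemma subsol_w : 0 <= w < 1.
Proof.
have p1 := subsol_p_ge1; have p0 : 0 < p by lra.
have i0 : 0 < p^-1 by rewrite invr_gt0.
have i1 : p^-1 <= 1 by rewrite invf_le1.
by rewrite /w; lra.
Qed.

Lemma subsol_rho : 0 <= rho < 1.
Proof. by rewrite /rho divr_ge0//= ltr_pdivrMr ?ltr0n// mul1r ltr_nat. Qed.

(** The number p is chosen so that rho solves the characteristic equation with
the real number w in place of the phase: both (1 - rho)^2 and rho (1 - w)
equal 1 / (n0 + 1)^2. *)
Lemma subsol_eq : rho ^+ 2 - (3 - w) * rho + 1 = 0.
Proof.
rewrite /rho /w /p -natr1; have : 0 < n0%:R :> R by rewrite ltr0n.
move: (n0%:R : R) => N N0; field.
by rewrite !gt_eqF//; lra.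
Qed.

(** An exact solution of the recurrence above the axis, decaying towards the
left and upwards. *)
Definition subsol (A : R) (y : int * int) : R := A * w ^+ absz (M - y.1) * rho ^+ absz y.2.

(** Comparison on the quadrant to the left of M and above the axis.  The quadrant
is closed under the in-neighbours used by the recurrence because horizontal
edges above the axis point to the right. *)
Lemma gker_ge_subsol A : 0 <= A ->
  (forall k, k <= M -> A * w ^+ absz (M - k) <= gker k%:~R 0) ->
  A * rho ^+ n0 <= gker M%:~R n0.
Proof.
move=> A0 bd.
have /andP[w0 w1] := subsol_w; have /andP[r0 r1] := subsol_rho.
pose v (y : int * int) : R :=
  if (y.1 <= M) && (0 <= y.2) then gker y.1%:~R (absz y.2) - subsol A y else 0.
have vv : vanishing v.
  move=> e e0.
  have e2 : 0 < e / 2 by rewrite divr_gt0.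
  have [N1 H1] := gker_vanishing e2.
  have eA : 0 < e / (2 * (A + 1)) by rewrite divr_gt0// mulr_gt0//; lra.
  have [N2 H2] := geom_small (introT andP (conj w0 w1)) eA.
  have [N3 H3] := geom_small (introT andP (conj r0 r1)) eA.
  exists (N1 + N2 + N3 + absz M)%N => -[a b] /= ab.
  rewrite /v /=; case: ifPn => [/andP[aM b0]|_]; last by rewrite normr0 ltW.
  have k1 : `|gker a%:~R (absz b) : R| <= e / 2 by apply: H1; clear -ab; lia.
  have AE : A * (e / (2 * (A + 1))) <= e / 2.
    rewrite mulrA ler_pdivrMr ?mulr_gt0//; last by lra.
    have -> : e / 2 * (2 * (A + 1)) = e * (A + 1) by field.
    by nra.
  have s0 : 0 <= subsol A (a, b) by rewrite !mulr_ge0 ?exprn_ge0.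
  have s1 : subsol A (a, b) <= e / 2.
    apply: le_trans AE; rewrite /subsol /= -mulrA ler_wpM2l//.
    have u1 : w ^+ absz (M - a) <= 1 by rewrite exprn_ile1// ltW.
    have u2 : rho ^+ absz b <= 1 by rewrite exprn_ile1// ltW.
    have u3 : 0 <= w ^+ absz (M - a) by rewrite exprn_ge0.
    have u4 : 0 <= rho ^+ absz b by rewrite exprn_ge0.
    have [h|h] := orP ab.
      have h2 : (N2 <= absz (M - a))%N by clear -h; lia.
      by have := H2 _ h2; nra.
    have h3 : (N3 <= absz b)%N by clear -h; lia.
    by have := H3 _ h3; nra.
  apply: le_trans (ler_normB _ _) _; rewrite (ger0_norm s0).
  by move: k1 s1; move: (`|_|) (subsol _ _) => q q'; lra.
have := min_principle vv; rewrite /= => H.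
have {}H : forall y, 0 <= v y.
  apply: H => -[a b] vy ymin.
  move: (vy); rewrite {1}/v /=; case: ifPn => [/andP[aM b0] _|_]; last by rewrite ltxx.
  case: b vy ymin b0 => [[|k]|k] vy ymin b0; last by [].
    exfalso; move: vy; rewrite /v /= aM /subsol /= expr0 mulr1 => vy.
    by have := bd _ aM; move: vy; move: (gker _ _) => q; lra.
  have c1 : v (a, k.+1%:Z) = gker a%:~R k.+1 - A * w ^+ absz (M - a) * rho ^+ k.+1.
    by rewrite /v /= aM.
  have c2 : v (a, k.+1%:Z + 1) = gker a%:~R k.+2 - A * w ^+ absz (M - a) * rho ^+ k.+2.
    by rewrite -PoszD addn1 /v /= aM.
  have c3 : v (a, k%:Z) = gker a%:~R k - A * w ^+ absz (M - a) * rho ^+ k.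
    by rewrite /v /= aM.
  (* moving left by one multiplies the comparison solution by w *)
have c4 : v (a - 1, k.+1%:Z) = gker (a%:~R - 1) k.+1 - A * w ^+ (absz (M - a)).+1 * rho ^+ k.+1.
    rewrite /v /=; have -> : a - 1 <= M by lia.
    rewrite rmorphB /= /subsol /=; congr (_ - _ * w ^+ _ * _).
    by lia.
  have := ymin (a, k%:Z); have := ymin (a - 1, k.+1%:Z).
  rewrite c4 c3 c2 c1.
  have := gker_rec (a%:~R : R) k.
  have : 3 * (A * w ^+ absz (M - a) * rho ^+ k.+1) = A * w ^+ absz (M - a) * rho ^+ k.+2
    + A * w ^+ absz (M - a) * rho ^+ k + A * w ^+ (absz (M - a)).+1 * rho ^+ k.+1.
    apply/eqP; rewrite -subr_eq0; apply/eqP.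
    transitivity (- (A * w ^+ absz (M - a) * rho ^+ k) * (rho ^+ 2 - (3 - w) * rho + 1)).
      by rewrite !exprS; ring.
    by rewrite subsol_eq mulr0.
  move: (_ * rho ^+ k.+1) (_ * rho ^+ k.+2) (_ * rho ^+ k) (_ * rho ^+ k.+1).
  move: (gker _ _) (gker _ _) (gker _ _) (gker _ _) => b1 b2 b3 b4 d1 d2 d3 d4; lra.
have := H (M, n0%:Z); rewrite /v /= lexx /= /subsol /= subrr expr0 mulr1.
by rewrite subr_ge0.
Qed.

(** Comparison with a solution of height n0 and width n0^2, the parabolic scale.
Its amplitude is dictated by the lower bound on the axis:
w^t <= p / (p + t) beats the growth of sqrt (1 + |k|). *)
Lemma gker_lower_bound (c : R) (B : R) : 0 < c -> 0 <= B ->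
  (forall k, c <= gker k%:~R 0 * Num.sqrt (1 + `|k%:~R|)) ->
  `|M%:~R| <= B * n0%:R ^+ 2 ->
  c * expR (-1) / (2 * Num.sqrt (B + 1)) <= n0%:R * gker M%:~R n0.
Proof.
move=> c0 B0 Hc MB.
have p1 := subsol_p_ge1; have p0 : 0 < p by lra.
have /andP[w0 w1] := subsol_w.
pose S : R := Num.sqrt ((B + 1) * p).
have S0 : 0 < S by rewrite sqrtr_gt0 mulr_gt0//; lra.
have S2 : S ^+ 2 = (B + 1) * p by rewrite sqr_sqrtr// mulr_ge0//; lra.
have n0R : 0 < n0%:R :> R by rewrite ltr0n.
have n02 : n0%:R ^+ 2 <= p.
  by rewrite /p -natr1 expr2 ler_wpM2l// lerDl.
have Ac : 0 <= c / S by rewrite divr_ge0 ?ltW.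
have main : c / S * rho ^+ n0 <= gker M%:~R n0.
  apply: gker_ge_subsol => // k kM.
  set t := absz (M - k).
  have kt : `|k%:~R : R| <= `|M%:~R| + t%:R.
    have -> : k%:~R = M%:~R - (M - k)%:~R :> R by rewrite rmorphB; ring.
    by apply: le_trans (ler_normB _ _) _; rewrite lerD2l /t natr_absz intr_norm.
  have pt : 0 < p + t%:R by rewrite ltr_wpDr.
  have k1 : 0 < 1 + `|k%:~R : R| by rewrite ltr_wpDr.
  have sk : 0 < Num.sqrt (1 + `|k%:~R : R|) by rewrite sqrtr_gt0.
  apply: (@le_trans _ _ (c / Num.sqrt (1 + `|k%:~R|))); last first.
    by rewrite ler_pdivrMr.
  rewrite -mulrA ler_pM2l// mulrC ler_pdivrMr// mulrC ler_pdivlMr//.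
  have wt : w ^+ t * (p + t%:R) <= p.
    have p01 : 0 <= p^-1 <= 1 by rewrite invr_ge0 ltW//= invf_le1.
    have := pow_bernoulli t p01; rewrite -/w.
    have -> : 1 + t%:R / p = (p + t%:R) / p by field; rewrite gt_eqF.
    by rewrite mulrA ler_pdivrMr// mul1r.
  have wt0 : 0 <= w ^+ t by rewrite exprn_ge0.
  rewrite -(@ler_pXn2r _ 2%N) ?nnegrE ?mulr_ge0 ?sqrtr_ge0 ?(ltW S0)//.
  rewrite exprMn sqr_sqrtr ?(ltW k1)// S2.
  have kpt : 1 + `|k%:~R : R| <= (B + 1) * (p + t%:R).
    have : B * n0%:R ^+ 2 <= B * p by rewrite ler_wpM2l.
    have : 0 <= B * t%:R by rewrite mulr_ge0.
    by move: kt MB; move: (`|_|) (`|_|) => q q'; lra.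
  have : (w ^+ t) ^+ 2 * (1 + `|k%:~R|) <= (w ^+ t) ^+ 2 * ((B + 1) * (p + t%:R)).
    by rewrite ler_wpM2l// sqr_ge0.
  move=> h; apply: le_trans h _.
  have u1 : w ^+ t <= 1 by rewrite exprn_ile1// ltW.
  rewrite expr2; move: (w ^+ t) wt wt0 u1 => q wt wt0 u1.
  have -> : q * q * ((B + 1) * (p + t%:R)) = (B + 1) * (q * (q * (p + t%:R))) by ring.
  rewrite ler_wpM2l//; first by lra.
  by nra.
have rn : expR (-1) <= rho ^+ n0.
  have h : rho^-1 <= expR (n0%:R^-1).
    apply: le_trans (expR_ge1Dx _); rewrite /rho invf_div -natr1.
    by rewrite mulrDl mul1r divff ?gt_eqF.
  have rho0 : 0 < rho by rewrite divr_gt0 ?ltr0n.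
  rewrite expRN -[leRHS]invrK lef_pV2 ?posrE ?expR_gt0 ?invr_gt0 ?exprn_gt0//.
  rewrite -exprVn; apply: le_trans (_ : expR (n0%:R^-1) ^+ n0 <= _).
    by rewrite lerXn2r ?nnegrE ?invr_ge0 ?expR_ge0// ltW.
  by rewrite -expRM_natl divff ?gt_eqF.
apply: (@le_trans _ _ (n0%:R * (c / S * expR (-1)))); last first.
  rewrite ler_wpM2l//; apply: le_trans main; by rewrite ler_wpM2l.
have SB : S <= 2 * Num.sqrt (B + 1) * n0%:R.
  rewrite -(@ler_pXn2r _ 2%N) ?nnegrE ?mulr_ge0 ?sqrtr_ge0 ?(ltW S0)//.
  rewrite S2 !exprMn sqr_sqrtr; last by lra.
  rewrite [2 ^+ 2 * _]mulrC -mulrA ler_wpM2l//; first by lra.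
  have n1 : 1 <= n0%:R :> R by rewrite ler1n.
  by rewrite /p -natr1; nra.
have sB : 0 < 2 * Num.sqrt (B + 1) by rewrite mulr_gt0// sqrtr_gt0; lra.
have ce : 0 <= c * expR (-1) by rewrite mulr_ge0 ?expR_ge0 ?ltW.
have -> : n0%:R * (c / S * expR (-1)) = c * expR (-1) * (n0%:R / S) by ring.
rewrite ler_wpM2l// ler_pdivlMr// mulrC ler_pdivrMr//.
by rewrite mulrC.
Qed.

End Subsolution.

End Potential.

(** * From the scaling limits to the asymptotic equivalents *)

Section Asymptotics.
Variable R : realType.
Implicit Types (z : int * int) (y : nat -> int * int).

(** Evaluate the convergence along m = floor (l n^2), where
[gker_lower_bound] keeps n [gker] m n away from 0. *)
Lemma near_limit_gt0 (l L : R) :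
  (forall e : R, 0 < e -> exists d N : R, 0 < d /\
    forall m n, N <= n%:R -> `|m / n%:R ^+ 2 - l| <= d ->
      `|n%:R * gker m n - L| <= e) -> 0 < L.
Proof.
move=> HL; have [c c0 Hc] := gker_axis_lower R.
have B0 : 0 <= `|l| + 1 by rewrite addr_ge0.
pose b := c * expR (-1) / (2 * Num.sqrt (`|l| + 1 + 1)).
have b0 : 0 < b.
  by rewrite divr_gt0 ?mulr_gt0 ?expR_gt0// sqrtr_gt0 ltr_pwDr.
have [d [N [d0 HN]]] := HL (b / 2) ltac:(lra).
pose n := (Num.bound (`|N| + d^-1)).+1.
have nN : `|N| + d^-1 <= n%:R.
  have Nd0 : 0 <= `|N| + d^-1 by rewrite addr_ge0 ?invr_ge0 ?(ltW d0).
  have /ltW h := archi_boundP Nd0.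
  by apply: le_trans h _; rewrite ler_nat.
have n0 : 0 < n%:R :> R by rewrite ltr0n.
have n1 : 1 <= n%:R :> R by rewrite ler1n.
pose M := Num.floor (l * n%:R ^+ 2).
have M1 : M%:~R <= l * n%:R ^+ 2 by exact: floor_le_tmp.
have M2 : l * n%:R ^+ 2 < M%:~R + 1 by have := floorD1_gt (l * n%:R ^+ 2); rewrite intrD.
have nn : 0 < n%:R ^+ 2 :> R by rewrite exprn_gt0.
have Md : `|M%:~R / n%:R ^+ 2 - l| <= d.
  have -> : M%:~R / n%:R ^+ 2 - l = (M%:~R - l * n%:R ^+ 2) / n%:R ^+ 2.
    by field; rewrite gt_eqF.
  rewrite normrM normfV (gtr0_norm nn) ler_pdivrMr// ler0_norm; last by lra.
  have dn : 1 <= d * n%:R.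
    rewrite mulrC -ler_pdivrMr// mul1r; apply: le_trans nN.
    by rewrite lerDr.
  by have : 1 <= d * n%:R ^+ 2; [rewrite expr2; nra|lra].
have Nn : N <= n%:R.
  by apply: le_trans nN; apply: le_trans (ler_norm _) _; rewrite lerDl invr_ge0 ltW.
have := HN M%:~R n Nn Md.
have MB : `|M%:~R| <= (`|l| + 1) * n%:R ^+ 2.
  have -> : M%:~R = l * n%:R ^+ 2 - (l * n%:R ^+ 2 - M%:~R) by ring.
  apply: le_trans (ler_normB _ _) _; rewrite normrM (gtr0_norm nn) mulrDl lerD2l.
  by rewrite ger0_norm; [nra|lra].
have := @gker_lower_bound R M n isT c (`|l| + 1) c0 B0 Hc MB.
rewrite -/b ler_norml; move: (_ * gker _ _) => q; lra.
Qed.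

Lemma asymp_equiv_real (a : nat -> \bar R) (b f : nat -> R) :
  (forall n, a n = (f n)%:E) ->
  (forall e : R, 0 < e -> \forall n \near \oo, 0 < b n /\ `|f n - b n| <= e * b n) ->
  asymp_equiv a b.
Proof.
move=> af H; rewrite /asymp_equiv.
have -> : (fun n => a n * ((b n)^-1)%:E)%E = (fun n => (f n / b n)%:E).
  by apply/funext => n; rewrite af EFinM.
apply: cvg_EFin; first by near=> n.
suff : f n / b n @[n --> \oo] --> (1 : R) by [].
apply/cvgrPdist_le => e e0; near=> n.
have [bn fb] : 0 < b n /\ `|f n - b n| <= e * b n by near: n; exact: H.
have -> : 1 - f n / b n = - (f n - b n) / b n by field; rewrite gt_eqF.
rewrite normrM normrN normfV (gtr0_norm bn) ler_pdivrMr//.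
Unshelve. all: by end_near. Qed.

Lemma powR_Nhalf (x : R) : 0 <= x -> x `^ (- 2^-1) = (Num.sqrt x)^-1.
Proof. by move=> x0; rewrite powRN powR12_sqrt. Qed.

Lemma norm_signed_shift z (u : int * int) :
  `|(signed_shift z u)%:~R : R| = `|u.1%:~R - z.1%:~R|.
Proof.
rewrite /signed_shift intrM normrM intrB.
by case: ifP => _; rewrite ?intrN ?normrN normr1 mul1r.
Qed.

Lemma norm_absz (k : int) : `|k%:~R : R| = (absz k)%:R.
Proof. by rewrite natr_absz intr_norm. Qed.

Lemma green_off_axis z (u : int * int) : z.2 = 0 -> u.2 != 0 ->
  green R z u = (3 / 2 * gker (signed_shift z u)%:~R (absz u.2))%:E.
Proof.
move=> z2 u2; rewrite green_gker// /deg (negbTE u2) /potential.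
by congr _%:E; rewrite mulrCA mulrC -mulrA mulrCA mulrA.
Qed.

Lemma asymp_far z y (L : R) : 0 < L ->
  (forall e : R, 0 < e -> exists d M : R, 0 < d /\
    forall m n, M <= `|m| -> n%:R <= d * Num.sqrt `|m| ->
      `|Num.sqrt `|m| * gker m n - L| <= e) ->
  z.2 = 0 -> (forall n, (y n).2 != 0) ->
  (forall A : R, \forall n \near \oo, A <= `|(y n).1%:~R * (y n).2%:~R ^- 2|) ->
  forall e : R, 0 < e -> \forall n \near \oo,
    0 < 3 / 2 * L * `|(y n).1%:~R - z.1%:~R| `^ (- 2^-1) /\
    `|3 / 2 * gker (signed_shift z (y n))%:~R (absz (y n).2)
       - 3 / 2 * L * `|(y n).1%:~R - z.1%:~R| `^ (- 2^-1)|
     <= e * (3 / 2 * L * `|(y n).1%:~R - z.1%:~R| `^ (- 2^-1)).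
Proof.
move=> L0 HL z2 y2 yA e e0.
have far (B : R) : 0 <= B ->
    \forall n \near \oo, B * (absz (y n).2)%:R ^+ 2 <= `|(y n).1%:~R - z.1%:~R|.
  move=> B0; near=> n.
  have : B + `|z.1%:~R| <= `|(y n).1%:~R * (y n).2%:~R ^- 2| by near: n; exact: yA.
  have k1 : 1 <= (absz (y n).2)%:R :> R by rewrite ler1n absz_gt0.
  have k2 : 1 <= (absz (y n).2)%:R ^+ 2 :> R by rewrite exprn_ege1.
  have kk0 : 0 < (absz (y n).2)%:R ^+ 2 :> R by lra.
  rewrite normrM normfV normrX (norm_absz (y n).2) ler_pdivlMr//.
  have zk := ler_wpM2l (normr_ge0 (z.1%:~R : R)) k2.
  have := lerB_dist ((y n).1%:~R : R) z.1%:~R.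
  by rewrite mulrDl; lra.
have [d [M [d0 HM]]] := HL (e * L) ltac:(by rewrite mulr_gt0).
pose B := `|M| + d ^- 2 + 1.
have d2 : 0 < d ^- 2 by rewrite invr_gt0 exprn_gt0.
have BM : M <= B by have := ler_norm M; rewrite /B; lra.
have B1 : 1 <= B by have := normr_ge0 M; rewrite /B; lra.
have Bd : d ^- 2 <= B by have := normr_ge0 M; rewrite /B; lra.
near=> n.
have k1 : 1 <= (absz (y n).2)%:R :> R by rewrite ler1n absz_gt0.
have k2 : 1 <= (absz (y n).2)%:R ^+ 2 :> R by rewrite exprn_ege1.
have : B * (absz (y n).2)%:R ^+ 2 <= `|(y n).1%:~R - z.1%:~R|.
  by near: n; apply: far; lra.
rewrite -norm_signed_shift => mB.
set m : R := (signed_shift z (y n))%:~R in mB *; set k := absz (y n).2 in k1 k2 mB *.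
have m0 : 0 < `|m| by nra.
have s0 : 0 < Num.sqrt `|m| by rewrite sqrtr_gt0.
have Mm : M <= `|m| by nra.
have kd : k%:R <= d * Num.sqrt `|m|.
  rewrite -(@ler_pXn2r _ 2%N) ?nnegrE ?mulr_ge0 ?sqrtr_ge0 ?(ltW d0)//.
  rewrite exprMn sqr_sqrtr// -ler_pdivrMl ?exprn_gt0//.
  by apply: le_trans mB; rewrite ler_pM2r//; lra.
have := HM m k Mm kd; rewrite powR_Nhalf//.
move: s0; move: (Num.sqrt _) (gker _ _) => s q s0 h.
have -> : 3 / 2 * q - 3 / 2 * L * s^-1 = 3 / 2 * s^-1 * (s * q - L).
  by field; rewrite gt_eqF.
have si : 0 < s^-1 by rewrite invr_gt0.
split; first by rewrite !mulr_gt0.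
rewrite normrM gtr0_norm ?mulr_gt0//.
have -> : e * (3 / 2 * L * s^-1) = 3 / 2 * s^-1 * (e * L) by ring.
by rewrite ler_pM2l// !mulr_gt0.
Unshelve. all: by end_near. Qed.

(** When the slope converges, |y.1| is at most a multiple of y.2^2, so only the
height can make the norm diverge. *)
Lemma height_to_infty y (l : R) : (forall n, (y n).2 != 0) ->
  lattice_norm R (y n) @[n --> \oo] --> +oo ->
  (y n).1%:~R * (y n).2%:~R ^- 2 @[n --> \oo] --> l ->
  forall A : R, \forall n \near \oo, A <= (absz (y n).2)%:R ^+ 2.
Proof.
move=> y2 ynorm yl A; near=> n.
have k1 : 1 <= (absz (y n).2)%:R :> R by rewrite ler1n absz_gt0.
have k2 : 1 <= (absz (y n).2)%:R ^+ 2 :> R by rewrite exprn_ege1.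
have h1 : `|l - (y n).1%:~R * (y n).2%:~R ^- 2| <= 1.
  by near: n; exact: (@cvgr_dist_le _ _ _ _ _ _ _ yl).
have h2 : (`|l| + 2) * `|A| <= lattice_norm R (y n).
  by near: n; have /cvgryPge := ynorm; apply.
have l0 := normr_ge0 l.
have a1 : `|(y n).1%:~R| <= (`|l| + 1) * (absz (y n).2)%:R ^+ 2 :> R.
  have : `|(y n).1%:~R * (y n).2%:~R ^- 2| <= `|l| + 1.
    by have := lerB_dist ((y n).1%:~R * (y n).2%:~R ^- 2 : R) l; rewrite distrC; lra.
  by rewrite normrM normfV normrX (norm_absz (y n).2) ler_pdivrMr//; lra.
have h3 : lattice_norm R (y n) <= (`|l| + 2) * (absz (y n).2)%:R ^+ 2.
  have rhs0 : 0 <= (`|l| + 2) * (absz (y n).2)%:R ^+ 2.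
    by apply: mulr_ge0; [lra|rewrite sqr_ge0].
  rewrite /lattice_norm -(@ler_pXn2r _ 2%N) ?nnegrE ?sqrtr_ge0//.
  rewrite sqr_sqrtr ?addr_ge0 ?sqr_ge0//.
  rewrite -[(y n).1%:~R ^+ 2]real_normK ?num_real// -[(y n).2%:~R ^+ 2]real_normK ?num_real//.
  rewrite (norm_absz (y n).2); move: a1 k2.
  have := normr_ge0 ((y n).1%:~R : R).
  move: (`|(y n).1%:~R|) (_ ^+ 2) => a q a0 aq q1.
  have : a ^+ 2 <= ((`|l| + 1) * q) ^+ 2 by apply: sqr_le.
  by rewrite !exprMn; nra.
have : (`|l| + 2) * `|A| <= (`|l| + 2) * (absz (y n).2)%:R ^+ 2 by exact: le_trans h3.
by rewrite ler_pM2l; [apply: le_trans; exact: ler_norm|lra].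
Unshelve. all: by end_near. Qed.

(** The sign sg is a parameter independent of n: along a sequence visiting both
sides of the axis the two signs are treated simultaneously and the relevant
one is chosen at each time. *)
Lemma asymp_near z y (l sg L : R) : `|sg| = 1 ->
  (forall e : R, 0 < e -> exists d N : R, 0 < d /\
    forall m n, N <= n%:R -> `|m / n%:R ^+ 2 - sg * l| <= d ->
      `|n%:R * gker m n - L| <= e) ->
  (forall n, (y n).2 != 0) ->
  lattice_norm R (y n) @[n --> \oo] --> +oo ->
  (y n).1%:~R * (y n).2%:~R ^- 2 @[n --> \oo] --> l ->
  forall e : R, 0 < e -> \forall n \near \oo,
    `|(absz (y n).2)%:R * gker (sg * ((y n).1%:~R - z.1%:~R)) (absz (y n).2) - L| <= e.
Proof.
move=> sg1 HL y2 ynorm yl e e0.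
have [d [N [d0 HN]]] := HL e e0.
have big := height_to_infty y2 ynorm yl.
near=> n.
have k1 : 1 <= (absz (y n).2)%:R :> R by rewrite ler1n absz_gt0.
have k0 : 0 < (absz (y n).2)%:R :> R by lra.
have kk0 : 0 < (absz (y n).2)%:R ^+ 2 :> R by rewrite exprn_gt0.
have h1 : `|l - (y n).1%:~R * (y n).2%:~R ^- 2| <= d / 2.
  by near: n; apply: (@cvgr_dist_le _ _ _ _ _ _ _ yl); rewrite divr_gt0.
have h2 : N ^+ 2 <= (absz (y n).2)%:R ^+ 2 by near: n; exact: big.
have h3 : 2 * `|z.1%:~R| / d <= (absz (y n).2)%:R ^+ 2 by near: n; exact: big.
have yk : (y n).2%:~R ^+ 2 = (absz (y n).2)%:R ^+ 2 :> R.
  by rewrite -(norm_absz (y n).2) real_normK ?num_real.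
rewrite yk in h1; apply: HN.
  by have := ler_norm N; have := normr_ge0 N; nra.
have -> : sg * ((y n).1%:~R - z.1%:~R) / (absz (y n).2)%:R ^+ 2 - sg * l =
  sg * (- (l - (y n).1%:~R / (absz (y n).2)%:R ^+ 2) - z.1%:~R / (absz (y n).2)%:R ^+ 2).
  by field; rewrite gt_eqF.
rewrite normrM sg1 mul1r; apply: le_trans (ler_normB _ _) _; rewrite normrN.
have : `|z.1%:~R / (absz (y n).2)%:R ^+ 2| <= d / 2.
  rewrite normrM normfV (gtr0_norm kk0) ler_pdivrMr//.
  by move: h3; rewrite ler_pdivrMr//; lra.
by move: h1; move: (`|_|) (`|_|) => p q; lra.
Unshelve. all: by end_near. Qed.

End Asymptotics.

Theorem proposition4p2 (R : realType) :
  exists s : \bar R -> R,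
    (forall lambda : \bar R, 0 < s lambda) /\
    forall (z : int * int) (y : nat -> int * int) (lambda : \bar R),
      z.2 = 0 ->
      (forall n, (y n).2 != 0) ->
      lattice_norm R (y n) @[n --> \oo] --> +oo ->
      ((y n).1%:~R * (y n).2%:~R ^- 2)%:E @[n --> \oo] --> lambda ->
      ((lambda = +oo%E \/ lambda = -oo%E) ->
         asymp_equiv (fun n => green R z (y n))
           (fun n => s lambda * `|(y n).1%:~R - z.1%:~R| `^ (- 2^-1)))
      /\
      (forall l : R, lambda = l%:E ->
         asymp_equiv (fun n => green R z (y n))
           (fun n => s (Num.sg (y n).2%:~R * l)%:E * `|(y n).2%:~R|^-1)).
Proof.
have [S HS] := choice (@gker_near R).
have [L L0 HL] := gker_far R.
have S0 l : 0 < S l by exact: near_limit_gt0 (HS l).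
exists (fun u => if u is l%:E then 3 / 2 * S l else 3 / 2 * L); split.
  by case=> [l||]; rewrite mulr_gt0.
move=> z y lambda z2 y2 ynorm ylam.
have greenE n := green_off_axis R z2 (y2 n).
split=> [lam_inf|l lamE].
  have far (A : R) : \forall n \near \oo, A <= `|(y n).1%:~R * (y n).2%:~R ^- 2|.
    case: lam_inf ylam => -> ylam.
      have /cvgeyPge/(_ A) H := ylam.
      by apply: filterS H => n; rewrite lee_fin => /le_trans; apply; exact: ler_norm.
    have /cvgeNyPle/(_ (- A)) H := ylam.
    apply: filterS H => n; rewrite lee_fin lerNr => /le_trans; apply.
    by rewrite -normrN ler_norm.
  rewrite (_ : (fun n => _ * _) = (fun n => 3 / 2 * L * `|(y n).1%:~R - z.1%:~R| `^ (- 2^-1))); last first.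
    by apply/funext => n; case: lam_inf => ->.
  apply: asymp_equiv_real greenE _ => e e0.
  exact: (asymp_far L0 HL z2 y2 far e0).
have yl : (y n).1%:~R * (y n).2%:~R ^- 2 @[n --> \oo] --> l.
  have : ((y n).1%:~R * (y n).2%:~R ^- 2)%:E @[n --> \oo] --> l%:E by rewrite -lamE.
  by move=> /fine_cvgP[_].
apply: asymp_equiv_real greenE _ => e e0.
(* near1 holds for both signs at once, whatever the sign of (y n).2 *)
have near1 (sg : R) : `|sg| = 1 -> \forall n \near \oo,
    `|(absz (y n).2)%:R * gker (sg * ((y n).1%:~R - z.1%:~R)) (absz (y n).2) - S (sg * l)|
    <= e * S (sg * l).
  by move=> sg1; apply: asymp_near sg1 (HS _) y2 ynorm yl _ _; rewrite mulr_gt0.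
near=> n.
have up : `|(absz (y n).2)%:R * gker (1 * ((y n).1%:~R - z.1%:~R)) (absz (y n).2) - S (1 * l)|
    <= e * S (1 * l) by near: n; apply: near1; rewrite normr1.
have down : `|(absz (y n).2)%:R * gker (-1 * ((y n).1%:~R - z.1%:~R)) (absz (y n).2) - S (-1 * l)|
    <= e * S (-1 * l) by near: n; apply: near1; rewrite normrN1.
set k := absz (y n).2 in up down *.
have k0 : 0 < k%:R :> R by rewrite ltr0n absz_gt0.
have kE : `|(y n).2%:~R : R| = k%:R by exact: norm_absz.
have main : `|k%:R * gker (signed_shift z (y n))%:~R k - S (Num.sg (y n).2%:~R * l)|
    <= e * S (Num.sg (y n).2%:~R * l).
  have [pos|neg] := leP 0 (y n).2.
    have -> : Num.sg ((y n).2%:~R : R) = 1 by rewrite gtr0_sg// ltr0z lt_def y2.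
    have -> : (signed_shift z (y n))%:~R = 1 * ((y n).1%:~R - z.1%:~R) :> R.
      by rewrite /signed_shift pos intrM intrB.
    exact: up.
  have -> : Num.sg ((y n).2%:~R : R) = -1 by rewrite ltr0_sg// ltrz0.
  have -> : (signed_shift z (y n))%:~R = -1 * ((y n).1%:~R - z.1%:~R) :> R.
    by rewrite /signed_shift leNgt neg intrM intrB intrN.
  exact: down.
rewrite kE; move: main (S0 (Num.sg (y n).2%:~R * l)).
move: (S _) (gker _ _) => s q main s0.
split; first by rewrite !mulr_gt0// invr_gt0.
have -> : 3 / 2 * q - 3 / 2 * s * k%:R^-1 = 3 / 2 * k%:R^-1 * (k%:R * q - s).
  by field; rewrite gt_eqF.
have ki : 0 < k%:R^-1 :> R by rewrite invr_gt0.
rewrite normrM gtr0_norm ?mulr_gt0//.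
have -> : e * (3 / 2 * s * k%:R^-1) = 3 / 2 * k%:R^-1 * (e * s) by ring.
by rewrite ler_pM2l// !mulr_gt0.
Unshelve. all: by end_near. Qed.
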